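(* Let $\Lambda$ be any finite simple graph. Then there exists a finite simple graph $\Gamma = \Gamma(\Lambda)$ such that (1) $A_\Lambda \cong \mathrm{PSO}(A_\Gamma)$, and (2) $\mathrm{PSO}(A_\Gamma)$ has finite index in $\mathrm{Out}(A_\Gamma)$. In particular, every right-angled Artin group is (isomorphic to) a finite-index subgroup of the outer automorphism group of some right-angled Artin group.
   Context: All graphs are finite, undirected, without loops or multiple edges. For a graph $\Gamma$ with vertex set $V(\Gamma)$ and edge set $E(\Gamma)$, the right-angled Artin group is $A_\Gamma = \langle V(\Gamma) \mid [v,w]=1 \text{ for } \{v,w\}\in E(\Gamma)\rangle$ (for the graph with no vertices, $A_\emptyset$ is the trivial group). An automorphism $\phi$ of $A_\Gamma$ is pure symmetric if for every vertex $v\in V(\Gamma)$, $\phi(v)$ is a conjugate of $v$ (the conjugating element may depend on $v$); these form a subgroup $\mathrm{PSA}(A_\Gamma)\le \mathrm{Aut}(A_\Gamma)$. The group of pure symmetric outer automorphisms $\mathrm{PSO}(A_\Gamma)$ is the image of $\mathrm{PSA}(A_\Gamma)$ in $\mathrm{Out}(A_\Gamma)=\mathrm{Aut}(A_\Gamma)/\mathrm{Inn}(A_\Gamma)$. *)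

(* Defs.v *)
From mathcomp Require Import all_boot.
From Stdlib Require Import Relations.
Set Implicit Arguments. Unset Strict Implicit. Unset Printing Implicit Defensive.

(* A finite simple graph is a finType V with a symmetric irreflexive rel e. *)

(* Words over the generators V and their inverses: (v,false) = v, (v,true) = v^-1. *)
Definition word (V : Type) := seq (V * bool).

Definition gen (V : Type) (v : V) : word V := [:: (v, false)].

Definition inv_word (V : Type) (w : word V) : word V :=
  rev (map (fun x => (x.1, ~~ x.2)) w).

Inductive raag_step (V : Type) (e : rel V) : word V -> word V -> Prop :=
| step_free u w v b :
    raag_step e (u ++ [:: (v, b); (v, ~~ b)] ++ w) (u ++ w)
| step_comm u w v1 b1 v2 b2 : e v1 v2 ->
    raag_step e (u ++ [:: (v1, b1); (v2, b2)] ++ w)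
                (u ++ [:: (v2, b2); (v1, b1)] ++ w).

Definition raag_eq (V : Type) (e : rel V) : relation (word V) :=
  clos_refl_sym_trans _ (raag_step e).

(* An endomorphism of A_Gamma is given by the images of the generators;
   subst g extends it to words. *)
Definition subst (W : Type) (g : W -> word W) (w : word W) : word W :=
  flatten (map (fun x => if x.2 then inv_word (g x.1) else g x.1) w).

(* g defines an endomorphism of A_f iff it respects the defining relations. *)
Definition is_endo (W : Type) (f : rel W) (g : W -> word W) : Prop :=
  forall v w, f v w -> raag_eq f (g v ++ g w) (g w ++ g v).

Definition aut_comp (W : Type) (g h : W -> word W) : W -> word W :=
  fun v => subst g (h v).

Definition is_auto (W : Type) (f : rel W) (g : W -> word W) : Prop :=
  is_endo f g /\
  exists h, is_endo f h /\
    forall v, raag_eq f (subst g (h v)) (gen v) /\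
              raag_eq f (subst h (g v)) (gen v).

Definition conj_by (W : Type) (c w : word W) : word W := inv_word c ++ w ++ c.

Definition is_PSA (W : Type) (f : rel W) (g : W -> word W) : Prop :=
  is_auto f g /\ forall v, exists c, raag_eq f (g v) (conj_by c (gen v)).

Definition out_eq (W : Type) (f : rel W) (g h : W -> word W) : Prop :=
  exists c, forall v, raag_eq f (g v) (conj_by c (h v)).

(* Main.v *)
(* The given graph is embedded in a larger one in which every vertex v of the former
   is joined to an independent set T (the [Sep i] below), and T separates a subgraph K
   (the [Inner i]) from the rest. Conjugating K by an element of the given group and
   fixing the other vertices defines the isomorphism onto the pure symmetric outer
   automorphisms.

   Surjectivity: a pure symmetric automorphism sends x to a conjugate of x whose set
   of conjugators is a coset of <star x>, and cosets of adjacent vertices meet. If no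
   two stars cover a set M of vertices, and no star separates M, these cosets have a
   common point for x in M. This applies to the complement of K and to the union
   of K and T, and the two common points differ by an element centralizing T.

   Finite index: no vertex of the larger graph is dominated by another. Comparing the
   ranks of centralizers in the abelianization shows that an automorphism acts there
   by a signed permutation s of the vertices, and then an element representing s(x)
   that commutes with elements representing s(y), for all y adjacent to x, must be
   conjugate to s(x) or its inverse. *)

From HB Require Import structures.
From Stdlib Require Import Relations Morphisms.
Require Import Defs.
From mathcomp Require Import all_boot all_fingroup all_algebra zify.

Set Implicit Arguments. Unset Strict Implicit. Unset Printing Implicit Defensive.

Import GRing.Theory Num.Theory.

(** * Monomial matrices *)

Lemma unitmx_transversal (R : comUnitRingType) n (A : 'M[R]_n) :
  A \in unitmx -> exists s : 'S_n, forall i, A i (s i) != 0%R.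
Proof.
case: (boolP [exists s : 'S_n, [forall i, A i (s i) != 0%R]]).
  by case/existsP=> s /forallP As_neq0; exists s.
rewrite negb_exists => /forallP no_transversal.
rewrite unitmxE /determinant big1 ?unitr0 // => s _.
have := no_transversal s; rewrite negb_forall => /existsP[i].
by rewrite negbK => /eqP Ai0; rewrite (bigD1 i) //= Ai0 mul0r mulr0.
Qed.

(* The case of interest is the action of an automorphism on the abelianization: [st]
   is adjacency or equality, and row [i] the image of the [i]-th generator. *)
Section UndominatedMonomial.
Local Open Scope ring_scope.
Variables (F : fieldType) (n : nat) (st : rel 'I_n) (A : 'M[F]_n).
Hypotheses (st_refl : reflexive st)
  (st_undominated : forall i j, (forall k, st i k -> k != i -> st j k) -> i = j)
  (A_unit : A \in unitmx)
  (A_minor0 : forall i p q r, st i p -> ~~ st q r -> A i q * A p r = A p q * A i r).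

Let star_proj i : 'M[F]_n := diag_mx (\row_j (st i j)%:R).

Let star_projM i (B : 'M[F]_n) p q : (star_proj i *m B) p q = (st i p)%:R * B p q.
Proof. by rewrite /star_proj mul_diag_mx !mxE. Qed.

Let Mstar_proj j (B : 'M[F]_n) p q : (B *m star_proj j) p q = B p q * (st j q)%:R.
Proof. by rewrite /star_proj mul_mx_diag !mxE. Qed.

(* The entries of these rows outside of the star of [j] are multiples of the [j]-th. *)
Let star_rows_factor i j : A i j != 0 ->
  exists K, star_proj i *m A = star_proj i *m A *m star_proj j *m K.
Proof.
move=> Aij_neq0.
exists (\matrix_(p, q)
  (if st j q then (p == q)%:R else (p == j)%:R * (A i q / A i j))).
apply/matrixP => p q; rewrite -!mulmxA !star_projM.
case st_ip: (st i p); last by rewrite !mul0r.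
rewrite !mul1r mulmxA mxE; case st_jq: (st j q).
  rewrite (bigD1 q) //= big1 => [|r r_neq]; rewrite Mstar_proj !mxE st_jq.
    by rewrite eqxx !mulr1 addr0.
  by rewrite (negPf r_neq) !mulr0.
rewrite (bigD1 j) //= big1 => [|r r_neq]; rewrite Mstar_proj !mxE st_jq.
  rewrite st_refl eqxx mulr1 mul1r addr0 mulrA -(@A_minor0 i p j q) ?st_jq //.
  by rewrite mulrAC divff // mul1r.
by rewrite (negPf r_neq) mul0r !mulr0.
Qed.

Let leqif_rank_star_proj i j : A i j != 0 ->
  (\rank (star_proj i) <= \rank (star_proj j)
     ?= iff (star_proj j <= star_proj i *m A *m star_proj j)%MS)%N.
Proof.
move=> /star_rows_factor[K rows_eq].
have -> : \rank (star_proj i) = \rank (star_proj i *m A *m star_proj j).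
  have A_free : row_free A by rewrite row_free_unit.
  rewrite -(mxrankMfree (star_proj i) A_free).
  by apply/eqP; rewrite eqn_leq {1}rows_eq !mxrankM_maxl.
by apply: mxrank_leqif_sup; apply: submxMl.
Qed.

Section Transversal.
Variable s : 'S_n.
Hypothesis As_neq0 : forall i, A i (s i) != 0.

(* The ranks of the projections have the same sum over [i] as over [s i]. *)
Let star_proj_sub i : (star_proj (s i) <= star_proj i *m A *m star_proj (s i))%MS.
Proof.
have : (\sum_i \rank (star_proj i) == \sum_i \rank (star_proj (s i)))%N.
  by rewrite [X in X == _](reindex_inj (@perm_inj _ s)).
have := leqif_sum (fun i (_ : xpredT i) => leqif_rank_star_proj (As_neq0 i)).
by case=> _ -> /forallP/(_ i).
Qed.

Let dual_row i t : st (s i) t -> exists y : 'rV[F]_n,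
  (forall r, st (s i) r -> y 0 r = (t == r)%:R) /\
  (forall q r, ~~ st q r -> A i q * y 0 r = y 0 q * A i r).
Proof.
move=> st_t; have /submxP[Z projE] := star_proj_sub i.
exists (row t (Z *m (star_proj i *m A))); split=> [r st_r|q r nst].
  rewrite [LHS]mxE; have := congr1 (fun B : 'M[F]_n => B t r) projE.
  rewrite mulmxA Mstar_proj st_r mulr1 => <-.
  by rewrite !mxE st_t; case: (t == r).
rewrite !mxE mulr_sumr mulr_suml; apply: eq_bigr => p _.
rewrite !star_projM; case st_ip: (st i p); last by rewrite !mul0r !mulr0 mul0r.
by rewrite !mul1r mulrCA A_minor0 // mulrA.
Qed.

Lemma transversal_monomial i j : A i j != 0 -> j = s i.
Proof.
move=> Aij_neq0; apply/esym; apply: st_undominated => t st_t t_neq.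
apply: contraT => nst_jt; have [y [y_st y_minor0]] := dual_row st_t.
have := y_minor0 j t nst_jt; rewrite (y_st t) // eqxx mulr1 => Aij.
suff y_j0 : y 0 j = 0 by rewrite Aij y_j0 mul0r eqxx in Aij_neq0.
case: (boolP (st (s i) j)) => [st_j|nst_j].
  by rewrite y_st //; case: eqP => // t_j; rewrite t_j st_refl in nst_jt.
have := y_minor0 _ _ nst_j; rewrite (y_st (s i)) // (negPf t_neq) mul0r => /eqP.
by rewrite mulf_eq0 (negPf (As_neq0 i)) => /eqP.
Qed.

End Transversal.

Lemma undominated_monomial : exists s : 'S_n, forall i j, A i j != 0 -> j = s i.
Proof.
by have [s As_neq0] := unitmx_transversal A_unit; exists s; apply: transversal_monomial.
Qed.

End UndominatedMonomial.

(** * Powers in free monoids *)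

Definition pow (T : Type) n (x : seq T) := flatten (nseq n x).

Lemma powS (T : Type) n (x : seq T) : pow n.+1 x = x ++ pow n x.
Proof. by []. Qed.

Lemma size_pow (T : Type) n (x : seq T) : size (pow n x) = n * size x.
Proof. by rewrite size_flatten /shape map_nseq sumn_nseq mulnC. Qed.

Lemma cat_pow_comm (T : Type) n (x y : seq T) :
  x ++ y = y ++ x -> pow n x ++ y = y ++ pow n x.
Proof.
move=> xy; elim: n => [|n IH]; first by rewrite cats0.
by rewrite powS -catA IH !catA xy.
Qed.

Lemma cat_comm_pow_eq (T : eqType) (x y : seq T) :
  x ++ y = y ++ x -> pow (size y) x = pow (size x) y.
Proof.
move=> xy; have := cat_pow_comm (size x) (esym (cat_pow_comm (size y) xy)).
by move/eqP; rewrite eqseq_cat ?size_pow 1?mulnC // => /andP[/eqP->].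
Qed.

(** * Words modulo the relations *)

#[global] Instance raag_eq_equiv (V : Type) (e : rel V) : Equivalence (raag_eq e).
Proof.
split=> [x|x y|x y z]; [exact: rst_refl|exact: rst_sym|exact: rst_trans].
Qed.

#[local] Hint Extern 0 (raag_eq _ _ _) => solve [apply: rst_refl] : core.

Lemma raag_eq_homo (V V' : Type) (e : rel V) (e' : rel V') (h : word V -> word V') :
  (forall x y, raag_step e x y -> raag_eq e' (h x) (h y)) ->
  forall x y, raag_eq e x y -> raag_eq e' (h x) (h y).
Proof.
move=> h_step x y; elim=> [? ? /h_step //|?|? ? _ ->|? ? ? _ -> _ ->] //.
Qed.

Lemma raag_eq_free (V : Type) (e : rel V) (a : V * bool) (x y : word V) :
  raag_eq e (x ++ a :: (a.1, ~~ a.2) :: y) (x ++ y).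
Proof. by case: a => v b; apply: rst_step; apply: step_free. Qed.

Lemma raag_eq_comm (V : Type) (e : rel V) (a b : V * bool) (x y : word V) :
  e a.1 b.1 -> raag_eq e (x ++ a :: b :: y) (x ++ b :: a :: y).
Proof. by case: a b => [v o] [w o'] e_vw; apply: rst_step; apply: step_comm. Qed.

#[global] Instance cat_raag_eq (V : Type) (e : rel V) :
  Proper (raag_eq e ==> raag_eq e ==> raag_eq e) (@cat (V * bool)).
Proof.
move=> x x' xx' y y' yy'; transitivity (x ++ y').
  apply: (raag_eq_homo (h := fun z => x ++ z)) yy' => _ _ [] *; rewrite !(catA x);
  by [apply: raag_eq_free|apply: raag_eq_comm].
apply: (raag_eq_homo (h := fun z => z ++ y')) xx' => _ _ [] *; rewrite -!catA;
by [apply: raag_eq_free|apply: raag_eq_comm].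
Qed.

#[global] Instance cons_raag_eq (V : Type) (e : rel V) (a : V * bool) :
  Proper (raag_eq e ==> raag_eq e) (cons a).
Proof. by move=> x y xy; rewrite -cat1s xy. Qed.

Section Inverse.
Variable V : Type.
Implicit Types (a : V * bool) (x y : word V).

Definition inv_letter a : V * bool := (a.1, ~~ a.2).

Lemma inv_letterK : involutive inv_letter.
Proof. by case=> v b; rewrite /inv_letter /= negbK. Qed.

Lemma inv_word_cons a x : inv_word (a :: x) = inv_word x ++ [:: inv_letter a].
Proof. by rewrite /inv_word /= rev_cons cats1. Qed.

Lemma inv_word_cat x y : inv_word (x ++ y) = inv_word y ++ inv_word x.
Proof. by rewrite /inv_word map_cat rev_cat. Qed.

Lemma inv_wordK : involutive (@inv_word V).
Proof.
by move=> x; rewrite /inv_word map_rev revK mapK //; apply: inv_letterK.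
Qed.

Lemma size_inv_word x : size (inv_word x) = size x.
Proof. by rewrite size_rev size_map. Qed.

End Inverse.

Section GroupLaws.
Variables (V : Type) (e : rel V).
Implicit Types (b c x y z : word V).

Lemma catwV x : raag_eq e (x ++ inv_word x) [::].
Proof.
elim: x => [|a x IH]; first by reflexivity.
rewrite inv_word_cons -cat1s -catA (catA x) IH.
exact: (raag_eq_free e a [::] [::]).
Qed.

Lemma catwVK x y : raag_eq e (x ++ inv_word x ++ y) y.
Proof. by rewrite catA catwV. Qed.

Lemma catVw x : raag_eq e (inv_word x ++ x) [::].
Proof. by rewrite -{2}[x]inv_wordK catwV. Qed.

Lemma catVwK x y : raag_eq e (inv_word x ++ x ++ y) y.
Proof. by rewrite catA catVw. Qed.

#[global] Instance inv_word_raag_eq : Proper (raag_eq e ==> raag_eq e) (@inv_word V).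
Proof.
move=> x y xy; rewrite -[inv_word x]cats0 -(catwV y) catA -{1}xy catVw.
by reflexivity.
Qed.

Lemma raag_eq_cat2l x y z : raag_eq e (x ++ y) (x ++ z) <-> raag_eq e y z.
Proof. by split=> [xyz|->//]; rewrite -(catVwK x y) xyz catVwK. Qed.

Lemma raag_eq_cat2r x y z : raag_eq e (y ++ x) (z ++ x) <-> raag_eq e y z.
Proof.
by split=> [xyz|->//]; rewrite -[y]cats0 -(catwV x) catA xyz -catA catwV cats0.
Qed.

#[global] Instance conj_by_raag_eq :
  Proper (raag_eq e ==> raag_eq e ==> raag_eq e) (@conj_by V).
Proof. by move=> c d cd x y xy; rewrite /conj_by cd xy. Qed.

Lemma conj_by_nil x : conj_by [::] x = x.
Proof. exact: cats0. Qed.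

Lemma conj_by_cat x y z : conj_by (x ++ y) z = conj_by y (conj_by x z).
Proof. by rewrite /conj_by inv_word_cat -!catA. Qed.

Lemma conj_byM c x y : raag_eq e (conj_by c (x ++ y)) (conj_by c x ++ conj_by c y).
Proof. by rewrite /conj_by -!catA catwVK. Qed.

Lemma conj_byK c x : raag_eq e (conj_by (inv_word c) (conj_by c x)) x.
Proof.
by rewrite -conj_by_cat /conj_by inv_word_cat inv_wordK -!catA catwVK catwV cats0.
Qed.

Definition commutes x y := raag_eq e (x ++ y) (y ++ x).

#[global] Instance commutes_raag_eq :
  Proper (raag_eq e ==> raag_eq e ==> iff) commutes.
Proof. by move=> x x' xx' y y' yy'; rewrite /commutes xx' yy'. Qed.

Lemma commutes_refl x : commutes x x.
Proof. exact: rst_refl. Qed.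

Lemma commutes_sym x y : commutes x y -> commutes y x.
Proof. by rewrite /commutes => ->. Qed.

Lemma commutes_cat x y z : commutes x y -> commutes x z -> commutes x (y ++ z).
Proof. by rewrite /commutes => xy xz; rewrite catA xy -catA xz catA. Qed.

Lemma commutes_invr x y : commutes x y -> commutes x (inv_word y).
Proof.
move=> xy; apply/(raag_eq_cat2l y).
by rewrite catwVK catA -xy -catA catwV cats0.
Qed.

Lemma commutes_invl x y : commutes x y -> commutes (inv_word x) y.
Proof. by move=> xy; apply/commutes_sym/commutes_invr/commutes_sym. Qed.

Lemma commutes_pow n x y : commutes x y -> commutes x (pow n y).
Proof.
move=> xy; elim: n => [|n IH]; last exact: commutes_cat.
by rewrite /commutes cats0.
Qed.

Lemma commutes_conj c x y : commutes (conj_by c x) (conj_by c y) <-> commutes x y.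
Proof.
rewrite /commutes -!conj_byM; split=> [xy|->//].
by rewrite -(conj_byK c (x ++ y)) xy conj_byK.
Qed.

Lemma conj_by_eqP b c x :
  raag_eq e (conj_by b x) (conj_by c x) <-> commutes x (b ++ inv_word c).
Proof.
rewrite /commutes -(raag_eq_cat2l b) -(raag_eq_cat2r (inv_word c)) /conj_by.
by rewrite -!catA !catwVK catwV cats0.
Qed.

Lemma conj_by_idP c x : raag_eq e (conj_by c x) x <-> commutes x c.
Proof. by have := conj_by_eqP c [::] x; rewrite conj_by_nil cats0. Qed.

End GroupLaws.

Section Subst.
Variables (W : Type) (f : rel W).
Implicit Types (g h : W -> word W) (x y : word W).

Lemma subst_cat g x y : subst g (x ++ y) = subst g x ++ subst g y.
Proof. by rewrite /subst map_cat flatten_cat. Qed.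

Lemma subst_inv g x : subst g (inv_word x) = inv_word (subst g x).
Proof.
elim: x => // -[v b] x IH; rewrite inv_word_cons subst_cat IH.
rewrite -[(v, b) :: x]cat1s subst_cat inv_word_cat; congr (_ ++ _).
by rewrite /subst /= !cats0; case: b; rewrite //= inv_wordK.
Qed.

Lemma subst_gen g v : subst g (gen v) = g v.
Proof. by rewrite /subst /= cats0. Qed.

Lemma subst_conj g c x : subst g (conj_by c x) = conj_by (subst g c) (subst g x).
Proof. by rewrite /conj_by !subst_cat subst_inv. Qed.

Lemma subst_id x : subst (@gen W) x = x.
Proof. by elim: x => // -[v []] x IH; rewrite -cat1s subst_cat IH. Qed.

Lemma subst_comp g h x : subst g (subst h x) = subst (aut_comp g h) x.
Proof.
elim: x => // -[v b] x IH; rewrite -cat1s !subst_cat IH; congr (_ ++ _).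
by rewrite /subst /= !cats0 -!/(subst _ _); case: b; rewrite // subst_inv.
Qed.

Lemma subst_raag_eq g : is_endo f g ->
  forall x y, raag_eq f x y -> raag_eq f (subst g x) (subst g y).
Proof.
move=> g_endo; apply: raag_eq_homo => _ _ [x y v b|x y v b w b' f_vw];
  rewrite !subst_cat; [apply/raag_eq_cat2l|apply/raag_eq_cat2l/raag_eq_cat2r].
  rewrite -[Y in raag_eq _ _ Y]cat0s; apply/raag_eq_cat2r.
  by rewrite /subst /= cats0; case: b => /=; [apply: catVw|apply: catwV].
have g_vw : commutes f (g v) (g w) by apply: g_endo.
rewrite /subst /= !cats0 -/(commutes f _ _).
by case: b; case: b' => //=; do ?[apply: commutes_invl|apply: commutes_invr].
Qed.

Lemma subst_ext g h : (forall v, raag_eq f (g v) (h v)) ->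
  forall x, raag_eq f (subst g x) (subst h x).
Proof.
move=> gh; elim=> [|[v b] x IH]; first by reflexivity.
rewrite -cat1s !subst_cat IH /subst /= !cats0.
by case: b; rewrite gh.
Qed.

Lemma gen_endo : is_endo f (@gen W).
Proof. by move=> s t f_st; apply: (@raag_eq_comm _ _ _ _ [::] [::]). Qed.

Lemma aut_comp_endo g h : is_endo f g -> is_endo f h -> is_endo f (aut_comp g h).
Proof.
move=> g_endo h_endo s t /h_endo h_st; rewrite /aut_comp -!subst_cat.
exact: subst_raag_eq.
Qed.

Lemma aut_comp_auto g h : is_auto f g -> is_auto f h -> is_auto f (aut_comp g h).
Proof.
move=> [g_endo [g' [g'_endo gg']]] [h_endo [h' [h'_endo hh']]].
split; first exact: aut_comp_endo.
exists (aut_comp h' g'); split=> [|v]; first exact: aut_comp_endo.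
have compK k k' l l' w : is_endo f k ->
    (forall v, raag_eq f (subst k (k' v)) (gen v)) ->
    (forall v, raag_eq f (subst l (l' v)) (gen v)) ->
    raag_eq f (subst (aut_comp k l) (aut_comp l' k' w)) (gen w).
  move=> k_endo kk' ll'; rewrite /aut_comp -subst_comp -(kk' w).
  apply: subst_raag_eq => //; rewrite subst_comp -[X in raag_eq f _ X]subst_id.
  exact: subst_ext.
by split; apply: compK => // w;
  [case: (gg' w)|case: (hh' w)|case: (hh' w)|case: (gg' w)].
Qed.

End Subst.

(** * Traces and reduced words *)

Section Trace.
Variables (W : eqType) (f : rel W).
Hypotheses (fsym : symmetric f) (firr : irreflexive f).

Implicit Types (a b : W * bool) (p q x y z w : word W) (s t : W).

Definition pair_proj s t w := [seq l <- w | (l.1 == s) || (l.1 == t)].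

(* By the projection lemma [trace_eq_raag_eq] below, two words with the same
   projections to all pairs of non-commuting generators differ by commutations only. *)
Definition trace_eq x y := forall s t, ~~ f s t -> pair_proj s t x = pair_proj s t y.

#[global] Instance trace_eq_equiv : Equivalence trace_eq.
Proof. by split=> [|x y xy|x y z xy yz] s t nf; rewrite ?xy ?yz. Qed.

Lemma pair_proj_cat s t x y : pair_proj s t (x ++ y) = pair_proj s t x ++ pair_proj s t y.
Proof. exact: filter_cat. Qed.

#[global] Instance cat_trace_eq :
  Proper (trace_eq ==> trace_eq ==> trace_eq) (@cat (W * bool)).
Proof. by move=> x x' xx' y y' yy' s t nf; rewrite !pair_proj_cat xx' ?yy'. Qed.

#[global] Instance cons_trace_eq a : Proper (trace_eq ==> trace_eq) (cons a).
Proof. by move=> x y xy; rewrite -cat1s xy. Qed.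

Lemma trace_eq_cat2l x y z : trace_eq (x ++ y) (x ++ z) -> trace_eq y z.
Proof.
move=> xyz s t nf; have := xyz s t nf; rewrite !pair_proj_cat.
by move/eqP; rewrite eqseq_cat // eqxx => /eqP.
Qed.

Lemma trace_eq_cons2 a x y : trace_eq (a :: x) (a :: y) -> trace_eq x y.
Proof. exact: (@trace_eq_cat2l [:: a]). Qed.

Lemma trace_eq_swap a b w : f a.1 b.1 -> trace_eq (a :: b :: w) (b :: a :: w).
Proof.
move=> f_ab s t nf; rewrite /pair_proj /=.
case: (boolP ((a.1 == s) || (a.1 == t))) => // /orP[] /eqP a_st;
case: (boolP ((b.1 == s) || (b.1 == t))) => // /orP[] /eqP b_st;
by move: f_ab; rewrite a_st b_st ?firr ?(fsym t) ?(negPf nf).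
Qed.

Lemma trace_eq_perm x y : trace_eq x y -> perm_eq x y.
Proof.
move=> xy; apply/allP => a _ /=; have := xy a.1 a.1; rewrite firr => /(_ isT) proj_xy.
have count_proj z : count_mem a z = count_mem a (pair_proj a.1 a.1 z).
  rewrite count_filter; apply: eq_count => l /=.
  by case: eqP => // ->; rewrite eqxx.
by rewrite count_proj proj_xy -count_proj.
Qed.

Lemma size_trace_eq x y : trace_eq x y -> size x = size y.
Proof. by move/trace_eq_perm/perm_size. Qed.

#[global] Instance all_trace_eq P : Proper (trace_eq ==> eq) (@all (W * bool) P).
Proof. by move=> x y /trace_eq_perm/perm_all. Qed.

#[global] Instance count_trace_eq P : Proper (trace_eq ==> eq) (@count (W * bool) P).
Proof. by move=> x y /trace_eq_perm/seq.permP. Qed.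

Definition in_link t w := all (fun l => f l.1 t) w.

Lemma trace_eq_rcons a w : in_link a.1 w -> trace_eq (w ++ [:: a]) (a :: w).
Proof.
elim: w => //= b w IH /andP[f_ba /IH ->]; exact: trace_eq_swap.
Qed.

(* [a] can be shuffled to the front of [w]; the trace of [w] is then that of
   [a :: rem a w]. *)
Fixpoint initial a w :=
  if w is b :: w' then (b == a) || f b.1 a.1 && initial a w' else false.

Lemma mem_initial a w : initial a w -> a \in w.
Proof.
by elim: w => //= b w IH /orP[/eqP->|/andP[_ /IH]]; rewrite inE ?eqxx // orbC => ->.
Qed.

Lemma initial_cat a p q :
  initial a (p ++ q) = initial a p || in_link a.1 p && initial a q.
Proof.
elim: p => //= b p ->; case: (b == a) => //=.
by case: (f b.1 a.1).
Qed.

Lemma initial_cons_adj a b w : f b.1 a.1 -> initial a (b :: w) = initial a w.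
Proof. by rewrite /=; case: eqP => [->|_ ->//]; rewrite firr. Qed.

Lemma initial_trace_eq_rem a w : initial a w -> trace_eq w (a :: rem a w).
Proof.
elim: w => //= b w IH; case: eqP => [->//|_ /= /andP[f_ba /IH w_eq]].
by rewrite {1}w_eq; apply: trace_eq_swap.
Qed.

Lemma initial_ohead b w : b \in w ->
  (forall s, ~~ f s b.1 -> ohead (pair_proj s b.1 w) = Some b) -> initial b w.
Proof.
elim: w => // d w IH b_dw heads /=; case: (d =P b) => //= d_neq.
have f_db : f d.1 b.1.
  by apply: contraT => /heads; rewrite /pair_proj /= eqxx => -[].
rewrite f_db; apply: IH => [|s nf].
  by move: b_dw; rewrite inE => /orP[/eqP e|//]; case: d_neq.
have := heads s nf; rewrite /pair_proj /=; case: ifP => // /orP[] /eqP d_eq.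
- by rewrite -d_eq f_db in nf.
- by rewrite d_eq firr in f_db.
Qed.

Lemma initialP a w : reflect (exists w', trace_eq w (a :: w')) (initial a w).
Proof.
apply: (iffP idP) => [/initial_trace_eq_rem|[w' w_eq]]; first by exists (rem a w).
apply: initial_ohead => [|s nf].
  by rewrite (perm_mem (trace_eq_perm w_eq)) mem_head.
by rewrite w_eq // /pair_proj /= eqxx orbT.
Qed.

#[global] Instance initial_trace_eq a : Proper (trace_eq ==> eq) (initial a).
Proof.
by move=> x y xy; apply/initialP/initialP => -[z z_eq];
   exists z; rewrite -z_eq xy.
Qed.

Lemma rem_trace_eq a x y : initial a x -> trace_eq x y -> trace_eq (rem a x) (rem a y).
Proof.
move=> a_x xy; have a_y : initial a y by rewrite -xy.
apply: (@trace_eq_cons2 a); rewrite -!initial_trace_eq_rem //.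
Qed.

Fixpoint reduced w :=
  if w is a :: w' then ~~ initial (inv_letter a) w' && reduced w' else true.

Lemma reduced_catr p q : reduced (p ++ q) -> reduced q.
Proof. by elim: p => //= a p IH /andP[_]. Qed.

Lemma reduced_catl p q : reduced (p ++ q) -> reduced p.
Proof.
elim: p => //= a p IH /andP[na /IH ->]; rewrite andbT.
by apply: contraNN na; rewrite initial_cat => ->.
Qed.

Lemma inv_letter_neq a : inv_letter a != a.
Proof. by case: a => v []; rewrite xpair_eqE andbF. Qed.

Lemma reduced_rem a w : initial a w -> ~~ initial (inv_letter a) (rem a w) ->
  reduced (rem a w) -> reduced w.
Proof.
elim: w => // b w IH; rewrite [initial a _]/= [rem a _]/=.
case: eqP => [->|_] /=; first by move=> _ -> ->.
rewrite -/(initial _ (b :: _)) => /andP[f_ba a_w].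
rewrite initial_cons_adj // => na /andP[nb red_w]; rewrite IH // andbT.
by rewrite (initial_trace_eq_rem a_w) initial_cons_adj // fsym.
Qed.

#[global] Instance reduced_trace_eq : Proper (trace_eq ==> eq) reduced.
Proof.
suff imp x y : trace_eq x y -> reduced x -> reduced y.
  by move=> x y xy; apply/idP/idP; apply: imp => //; symmetry.
elim: x y => [|a x IH] y xy /=; first by case: y xy => // b y /size_trace_eq.
have a_y : initial a y by rewrite -xy /= eqxx.
have x_eq : trace_eq x (rem a y).
  by apply: (@trace_eq_cons2 a); rewrite -initial_trace_eq_rem.
by case/andP=> na red_x; apply: (reduced_rem a_y); rewrite -?x_eq // IH.
Qed.

Definition cons_reduce a w :=
  if initial (inv_letter a) w then rem (inv_letter a) w else a :: w.

Lemma cons_reduce_inv a w w' :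
  trace_eq w (inv_letter a :: w') -> trace_eq (cons_reduce a w) w'.
Proof.
move=> w_eq; have a_w : initial (inv_letter a) w by rewrite w_eq /= eqxx.
by rewrite /cons_reduce a_w (rem_trace_eq a_w w_eq) /= eqxx.
Qed.

#[global] Instance cons_reduce_trace_eq a :
  Proper (trace_eq ==> trace_eq) (cons_reduce a).
Proof.
move=> x y xy; case: (boolP (initial (inv_letter a) y)) => [a_y|na_y].
  rewrite {2}/cons_reduce a_y; apply: cons_reduce_inv.
  by rewrite xy; apply: initial_trace_eq_rem.
have na_x : ~~ initial (inv_letter a) x by rewrite xy.
by rewrite /cons_reduce (negPf na_x) (negPf na_y) xy.
Qed.

Lemma reduced_cons_reduce a w : reduced w -> reduced (cons_reduce a w).
Proof.
rewrite /cons_reduce; case: ifP => [a_w|na_w] /=; last by rewrite na_w.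
by rewrite {1}(initial_trace_eq_rem a_w) => /andP[].
Qed.

Lemma cons_reduceK a w :
  reduced w -> trace_eq (cons_reduce a (cons_reduce (inv_letter a) w)) w.
Proof.
move=> red_w; rewrite {2}/cons_reduce inv_letterK.
case: ifP => [a_w|_]; last exact: cons_reduce_inv.
have w_eq := initial_trace_eq_rem a_w.
by move: red_w; rewrite {1 3}w_eq /= => /andP[na _]; rewrite /cons_reduce (negPf na).
Qed.

Lemma cons_reduce_cons_adj a b w :
  f a.1 b.1 -> trace_eq (cons_reduce a (b :: w)) (b :: cons_reduce a w).
Proof.
move=> f_ab; rewrite {2}/cons_reduce; case: ifP => [a_w|na_w].
  apply: cons_reduce_inv; rewrite {1}(initial_trace_eq_rem a_w).
  by apply: trace_eq_swap; rewrite fsym.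
rewrite /cons_reduce initial_cons_adj ?na_w 1?fsym //.
exact: trace_eq_swap.
Qed.

Lemma initial_cons_reduce_adj a b w :
  f a.1 b.1 -> initial a (cons_reduce b w) = initial a w.
Proof.
move=> f_ab; rewrite /cons_reduce; case: ifP => [b_w|_].
  by rewrite [in RHS](initial_trace_eq_rem b_w) initial_cons_adj // fsym.
by rewrite initial_cons_adj // fsym.
Qed.

Lemma cons_reduce_comm a b w : f a.1 b.1 ->
  trace_eq (cons_reduce a (cons_reduce b w)) (cons_reduce b (cons_reduce a w)).
Proof.
move=> f_ab; rewrite {2}/cons_reduce; case: ifP => [b_w|nb_w].
  symmetry; apply: cons_reduce_inv; rewrite {1}(initial_trace_eq_rem b_w).
  exact: cons_reduce_cons_adj.
rewrite cons_reduce_cons_adj // {2}/cons_reduce.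
by rewrite initial_cons_reduce_adj ?nb_w // fsym.
Qed.

Definition reduce w := foldr cons_reduce [::] w.

Lemma reduced_reduce w : reduced (reduce w).
Proof. by elim: w => //= a w; apply: reduced_cons_reduce. Qed.

Lemma reduce_id w : reduced w -> reduce w = w.
Proof.
by elim: w => //= a w IH /andP[na /IH ->]; rewrite /cons_reduce (negPf na).
Qed.

#[global] Instance reduce_raag_eq : Proper (raag_eq f ==> trace_eq) reduce.
Proof.
have foldr_eq p x y :
    trace_eq x y -> trace_eq (foldr cons_reduce x p) (foldr cons_reduce y p).
  by move=> xy; elim: p => //= a p ->.
move=> x y; elim=> [_ _ []|//|? ? _ ->|? ? ? _ -> _ ->] // p q.
  move=> v b; rewrite /reduce !foldr_cat; apply: foldr_eq.
  by apply: (@cons_reduceK (v, b)); apply: reduced_reduce.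
move=> v b w b' f_vw; rewrite /reduce !foldr_cat; apply: foldr_eq.
exact: cons_reduce_comm.
Qed.

Lemma initial_raag_eq_rem a w : initial a w -> raag_eq f w (a :: rem a w).
Proof.
elim: w => //= b w IH; case: eqP => [->//|_ /= /andP[f_ba /IH w_eq]].
by rewrite {1}w_eq; apply: (raag_eq_comm [::]).
Qed.

Lemma trace_eq_raag_eq x y : trace_eq x y -> raag_eq f x y.
Proof.
elim: x y => [|a x IH] y xy; first by case: y xy => // b y /size_trace_eq.
have a_y : initial a y by rewrite -xy /= eqxx.
rewrite (initial_raag_eq_rem a_y) (IH (rem a y)) //.
by apply: (@trace_eq_cons2 a); rewrite -initial_trace_eq_rem.
Qed.

Lemma raag_eq_reduce w : raag_eq f w (reduce w).
Proof.
elim: w => //= a w IH; rewrite {1}IH /cons_reduce; case: ifP => // a_w.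
rewrite {1}(initial_raag_eq_rem a_w).
exact: (raag_eq_free f a [::]).
Qed.

Lemma reduced_raag_eq x y : reduced x -> reduced y -> raag_eq f x y -> trace_eq x y.
Proof. by move=> red_x red_y xy; rewrite -(reduce_id red_x) xy reduce_id. Qed.

Lemma size_cons_reduce a w : size (cons_reduce a w) <= (size w).+1.
Proof.
rewrite /cons_reduce; case: ifP => // /mem_initial/size_rem ->.
by case: (size w) => //= n; rewrite ltnW.
Qed.

Lemma size_reduce_cat p q : size (reduce (p ++ q)) <= size p + size (reduce q).
Proof.
by elim: p => //= a p IH; apply: leq_trans (size_cons_reduce _ _) _; rewrite addSn ltnS.
Qed.

Lemma size_reduce w : size (reduce w) <= size w.
Proof. by have := size_reduce_cat w [::]; rewrite cats0 addn0. Qed.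

Lemma size_reduce_eq x y : raag_eq f x y -> size (reduce x) = size (reduce y).
Proof.
by move=> xy; have /size_trace_eq: trace_eq (reduce x) (reduce y) by rewrite xy.
Qed.

Lemma reduced_size w : size w <= size (reduce w) -> reduced w.
Proof.
elim: w => //= a w IH le_size; have red_w : reduced w.
  by apply: IH; rewrite -ltnS; apply: leq_trans le_size (size_cons_reduce _ _).
rewrite red_w andbT; apply: contraL le_size => a_w.
rewrite reduce_id // /cons_reduce a_w size_rem ?mem_initial // -ltnNge.
by case: (size w).
Qed.

Lemma reduced_inv w : reduced w -> reduced (inv_word w).
Proof.
move=> red_w; apply: reduced_size; rewrite size_inv_word -{1}(reduce_id red_w).
rewrite (@size_reduce_eq _ (inv_word (reduce (inv_word w)))).
  by apply: leq_trans (size_reduce _) _; rewrite size_inv_word.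
by rewrite -raag_eq_reduce inv_wordK.
Qed.

Lemma reduced_cat_or_cancel p q : reduced p -> reduced q -> reduced (p ++ q) \/
  exists a p' q', trace_eq p (p' ++ [:: a]) /\ trace_eq q (inv_letter a :: q').
Proof.
elim: p => [|b p IH] /=; first by left.
move=> /andP[nb red_p] red_q.
case: (IH red_p red_q) => [->|[a [p' [q' [p_eq q_eq]]]]]; last first.
  by right; exists a, (b :: p'), q'; rewrite p_eq.
rewrite andbT initial_cat (negPf nb) /=; case: andP => [[b_link b_q]|_]; last by left.
right; exists b, p, (rem (inv_letter b) q); split.
  by rewrite -trace_eq_rcons.
exact: initial_trace_eq_rem.
Qed.

End Trace.

(* Setoid rewriting uses these to discharge the hypotheses of the instances above. *)
#[local] Hint Extern 0 (symmetric _) => assumption : typeclass_instances.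
#[local] Hint Extern 0 (irreflexive _) => assumption : typeclass_instances.

(** * Subgroups generated by vertices and centralizers of vertices *)

Section Retract.
Variables (W : Type) (f : rel W).
Implicit Types (S : pred W) (c x y : word W).

Definition retract S x := [seq l <- x | S l.1].

#[global] Instance retract_raag_eq S : Proper (raag_eq f ==> raag_eq f) (retract S).
Proof.
move=> x y; apply: raag_eq_homo => _ _ [p q v b|p q v b w b' f_vw];
rewrite /retract !filter_cat /=.
  by case: (S v) => //; apply: (raag_eq_free f (v, b)).
by case: (S v); case: (S w) => //; apply: raag_eq_comm.
Qed.

Lemma retract_cat S x y : retract S (x ++ y) = retract S x ++ retract S y.
Proof. exact: filter_cat. Qed.

Lemma retract_inv S x : retract S (inv_word x) = inv_word (retract S x).
Proof. by rewrite /retract /inv_word filter_rev filter_map. Qed.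

Lemma retract_conj S c x :
  retract S (conj_by c x) = conj_by (retract S c) (retract S x).
Proof. by rewrite /conj_by !retract_cat retract_inv. Qed.

(* Membership in the subgroup generated by [S], onto which [retract S] retracts. *)
Definition supported S x := raag_eq f (retract S x) x.

#[global] Instance supported_raag_eq S : Proper (raag_eq f ==> iff) (supported S).
Proof. by move=> x y xy; rewrite /supported xy. Qed.

Lemma supported_cat S x y : supported S x -> supported S y -> supported S (x ++ y).
Proof. by rewrite /supported retract_cat => -> ->. Qed.

Lemma supported_inv S x : supported S x -> supported S (inv_word x).
Proof. by rewrite /supported retract_inv => ->. Qed.

Lemma supported_retract S x : supported S (retract S x).
Proof. by rewrite /supported /retract filter_id. Qed.

Lemma all_supported S x : all (fun l => S l.1) x -> supported S x.
Proof. by rewrite /supported /retract => /all_filterP ->. Qed.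

End Retract.

Section Star.
Variables (W : eqType) (f : rel W).
Hypotheses (fsym : symmetric f) (firr : irreflexive f).
Implicit Types (a b : W * bool) (x y z : word W) (s t : W) (S : pred W).

Lemma all_reduce (P : pred (W * bool)) x : all P x -> all P (reduce f x).
Proof.
elim: x => //= a x IH /andP[Pa /IH P_red]; rewrite /cons_reduce.
case: ifP => /= _; last by rewrite Pa.
by apply/allP => l /mem_rem; apply: (allP P_red).
Qed.

Lemma supported_reduce S x : supported f S x -> all (fun l => S l.1) (reduce f x).
Proof.
by move=> Sx; rewrite -Sx; apply: all_reduce; apply: filter_all.
Qed.

Lemma supported_eq1 x :
  (forall s, exists2 S : pred W, ~~ S s & supported f S x) -> raag_eq f x [::].
Proof.
move=> avoid; rewrite (raag_eq_reduce f x); case red_x: (reduce f x) => [|a z] //.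
by have [S nS /supported_reduce] := avoid a.1; rewrite red_x /= (negPf nS).
Qed.

Definition star s : pred W := fun t => (t == s) || f s t.

Lemma star_refl s : star s s. Proof. by rewrite /star eqxx. Qed.

Lemma star_sym s t : star s t = star t s.
Proof. by rewrite /star eq_sym fsym. Qed.

Lemma commutes_letter s a : star s a.1 -> commutes f (gen s) [:: a].
Proof.
case: a => t b /orP[/eqP /= ->|f_st]; last exact: (raag_eq_comm [::]).
by case: b; [apply: (@commutes_invr _ f (gen s) (gen s))|]; apply: commutes_refl.
Qed.

Lemma star_commutes s x : supported f (star s) x -> commutes f (gen s) x.
Proof.
rewrite /supported => <-; elim: x => [|a x IH]; first by rewrite /commutes cats0.
rewrite /=; case: ifP => // st_a; rewrite -cat1s.
by apply: commutes_cat => //; apply: commutes_letter.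
Qed.

(* Otherwise [gen s ++ x] and [x ++ gen s] are reduced, hence equal as traces, and the
   first letter of [x] is adjacent to [s]. *)
Lemma commutes_reduced_initial s x : reduced f x -> x != [::] ->
  commutes f (gen s) x -> exists2 a, star s a.1 & initial f a x.
Proof.
move=> red_x x_neq0 s_x.
case: (boolP (has (fun a => star s a.1 && initial f a x) x)) => [/hasP[a _ /andP[]]|].
  by exists a.
move=> /hasPn no_initial; exfalso.
have {}no_initial a : star s a.1 -> ~~ initial f a x.
  move=> st_a; apply/negP => a_x.
  by have := no_initial a (mem_initial a_x); rewrite st_a a_x.
have red_sx : reduced f (gen s ++ x) by rewrite /= red_x no_initial ?star_refl.
have red_xs : reduced f (x ++ gen s).
  apply: reduced_size; rewrite -(size_reduce_eq fsym firr s_x) reduce_id //.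
  by rewrite !size_cat addnC.
have : initial f (s, false) (x ++ gen s).
  by rewrite -(reduced_raag_eq fsym firr red_sx red_xs s_x) /= eqxx.
rewrite initial_cat (negPf (no_initial (s, false) (star_refl s))) /=.
case: x x_neq0 no_initial {red_x s_x red_sx red_xs} => // b x _ no_initial.
case/andP=> /andP[f_bs _] _; have st_b : star s b.1 by rewrite /star fsym f_bs orbT.
by have := no_initial b st_b; rewrite /= eqxx.
Qed.

Lemma commutes_star s x : commutes f (gen s) x -> supported f (star s) x.
Proof.
rewrite (raag_eq_reduce f x); have := reduced_reduce fsym firr x.
move: (reduce f x) => {}x; have [n] := ubnP (size x).
elim: n x => // n IH x /ltnSE le_n red_x s_x; have [->|x_neq0] := eqVneq x [::].
  exact: all_supported.
have [a st_a a_x] := commutes_reduced_initial red_x x_neq0 s_x.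
have x_eq := initial_trace_eq_rem fsym firr a_x.
rewrite (initial_raag_eq_rem a_x) -cat1s; apply: supported_cat.
  by apply: all_supported; rewrite /= st_a.
apply: IH; first by move: le_n; rewrite (size_trace_eq firr x_eq).
  by move: red_x; rewrite (reduced_trace_eq fsym firr x_eq) => /andP[].
rewrite -(catVwK f [:: a] (rem a x)); apply: commutes_cat.
  by apply: commutes_invr; apply: commutes_letter.
by rewrite cat1s -(initial_raag_eq_rem a_x).
Qed.

Lemma commutes_genP s x : commutes f (gen s) x <-> supported f (star s) x.
Proof. by split; [apply: commutes_star|apply: star_commutes]. Qed.

End Star.

(** * Cosets of stars with a common point *)

Section HalfSpaces.
Variables (W : eqType) (f : rel W).
Hypotheses (fsym : symmetric f) (firr : irreflexive f).
Implicit Types (a b l : W * bool) (c d q x y z : word W) (s t : W) (S : pred W).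

Lemma adjacent_star_cosets_meet s t x y :
  f s t -> commutes f (conj_by x (gen s)) (conj_by y (gen t)) ->
  exists z, supported f (star f s) (z ++ inv_word x) /\
            supported f (star f t) (z ++ inv_word y).
Proof.
move=> f_st xs_yt; pose d := y ++ inv_word x; pose d' := retract (star f s) d.
have s_dt : supported f (star f s) (conj_by d (gen t)).
  apply/(commutes_genP fsym firr)/(commutes_conj f x).
  by rewrite -conj_by_cat /d -catA catVw cats0; apply: xs_yt.
have : raag_eq f (conj_by d' (gen t)) (conj_by d (gen t)).
  by rewrite -s_dt retract_conj [retract _ (gen t)]/= /star f_st orbT.
move/conj_by_eqP/(commutes_genP fsym firr) => t_dd.
exists (d' ++ x); split.
  by rewrite -catA catwV cats0; apply: supported_retract.
by move: t_dd; rewrite /d inv_word_cat inv_wordK catA.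
Qed.

Definition ends_with c y := exists z, raag_eq f y (z ++ c) /\ reduced f (z ++ c).

#[global] Instance ends_with_raag_eq c : Proper (raag_eq f ==> iff) (ends_with c).
Proof.
by move=> x y xy; split=> -[z [z_eq red_zc]]; exists z; split; rewrite // ?xy // -xy.
Qed.

Lemma ends_with_catr c d y : ends_with (c ++ d) y -> ends_with d y.
Proof. by case=> z [y_eq red_zcd]; exists (z ++ c); rewrite -catA. Qed.

Definition starts_only s c := forall b, initial f b c -> b.1 = s.

(* For [c] with first letters labelled [s] only, the words ending with [c] form a
   half-space bounded by a hyperplane labelled [s]. *)
Lemma ends_with_cons c s a y :
  starts_only s c -> a.1 != s -> ends_with c y -> ends_with c (a :: y).
Proof.
move=> c_s a_neq_s [z [y_eq red_zc]].
case: (boolP (initial f (inv_letter a) (z ++ c))) => [|na].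
  rewrite initial_cat => /orP[a_z|/andP[_ /c_s /eqP]]; last by rewrite (negPf a_neq_s).
  have z_eq := initial_trace_eq_rem fsym firr a_z.
  exists (rem (inv_letter a) z); split.
    rewrite y_eq {1}(initial_raag_eq_rem a_z).
    exact: (raag_eq_free f a [::]).
  by move: red_zc; rewrite {1}z_eq => /andP[].
by exists (a :: z); rewrite y_eq /= na.
Qed.

Lemma ends_with_star c s t x y : starts_only s c -> ~~ star f t s ->
  supported f (star f t) x -> ends_with c y -> ends_with c (x ++ y).
Proof.
move=> c_s nts t_x c_y; rewrite -t_x.
elim: x {t_x} => //= a x IH; case: ifP => // ta.
by apply: (ends_with_cons c_s) => //; apply: contraNneq nts => <-.
Qed.

Lemma starts_only_suffix a q : exists z q',
  trace_eq f (a :: q) (z ++ a :: q') /\ starts_only a.1 (a :: q').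
Proof.
have [n] := ubnP (size q); elim: n q => // n IH q /ltnSE le_n.
case: (boolP (has (fun b => (b.1 != a.1) && initial f b (a :: q)) q)).
  case/hasP=> b _ /andP[b_neq /= /orP[/eqP a_b|/andP[f_ab b_q]]].
    by rewrite a_b eqxx in b_neq.
  have q_eq := initial_trace_eq_rem fsym firr b_q.
  have [|z [q' [rem_eq q'_a]]] := IH (rem b q).
    by move: le_n; rewrite (size_trace_eq firr q_eq).
  exists (b :: z), q'; split=> //=.
  by rewrite -rem_eq {1}q_eq; apply: trace_eq_swap.
move/hasPn => only_a; exists [::], q; split=> // b b_aq.
case/orP: (b_aq) => [/eqP->//|/andP[_ /mem_initial/only_a]].
by rewrite b_aq andbT negbK => /eqP.
Qed.

Definition length_off S x := count (fun l => ~~ S l.1) (reduce f x).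

#[global] Instance length_off_raag_eq S : Proper (raag_eq f ==> eq) (length_off S).
Proof. by move=> x y xy; rewrite /length_off xy. Qed.

Lemma length_off_inv S x : length_off S (inv_word x) = length_off S x.
Proof.
rewrite (raag_eq_reduce f x) /length_off (reduce_id (reduced_reduce fsym firr x)).
rewrite reduce_id; last exact/reduced_inv/reduced_reduce.
by rewrite count_rev count_map; apply: eq_count.
Qed.

Lemma length_off_rcons S x a : S a.1 -> length_off S (x ++ [:: a]) = length_off S x.
Proof.
move=> Sa; rewrite -length_off_inv -[RHS]length_off_inv inv_word_cat.
rewrite /length_off /= /cons_reduce; case: ifP => [a_x|_] /=; last by rewrite Sa.
by rewrite [in RHS](initial_trace_eq_rem fsym firr a_x) /= Sa.
Qed.

Lemma length_off_eq0 S x : length_off S x = 0 -> supported f S x.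
Proof.
move/eqP; rewrite eqn0Ngt -has_count => no_letter.
rewrite (raag_eq_reduce f x); apply: all_supported.
by rewrite -[all _ _]negbK -has_predC.
Qed.

Lemma length_off_ends_with S x l : ~~ S l.1 -> ends_with [:: l] x ->
  length_off S x = (length_off S (x ++ [:: inv_letter l])).+1.
Proof.
move=> nSl [y [x_eq red_yl]]; rewrite x_eq -catA /= (raag_eq_free f l y [::]) cats0.
rewrite /length_off (reduce_id red_yl) (reduce_id (reduced_catl red_yl)).
by rewrite count_cat /= nSl addn0 addn1.
Qed.

End HalfSpaces.

(* Think of the right coset <star x>(b x) as a convex set of the Cayley graph. It
   lies on one side of any hyperplane labelled by a letter outside of the star of
   [x], and by connectedness on the same side for all such [x] in [M]. Crossing a
   hyperplane that separates these cosets from 1 decreases the number of letters of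
   the [b x] outside of the star of [x]. *)
Section StarCosets.
Variables (W : finType) (f : rel W).
Hypotheses (fsym : symmetric f) (firr : irreflexive f).
Implicit Types (x y s t : W) (b : W -> word W).

Definition off_star s : rel W :=
  fun x y => [&& ~~ star f s x, ~~ star f s y & f x y].

Definition unseparated_by_stars (M : pred W) := forall s x y,
  M x -> M y -> ~~ star f s x -> ~~ star f s y -> connect (off_star s) x y.

Definition uncovered_by_two_stars (M : pred W) := forall s t,
  exists x, [/\ M x, ~~ star f s x & ~~ star f t x].

Definition commuting_conjugates b := forall x y,
  f x y -> commutes f (conj_by (b x) (gen x)) (conj_by (b y) (gen y)).

Definition star_coset_ends_with b c x :=
  forall z, supported f (star f x) z -> ends_with f c (z ++ b x).

Lemma star_coset_ends_with_adj b c s x y : commuting_conjugates b ->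
  starts_only f s c -> off_star s x y ->
  star_coset_ends_with b c x -> star_coset_ends_with b c y.
Proof.
move=> b_comm c_s /and3P[_ nsy f_xy] c_x z y_z.
have [d [x_d y_d]] := adjacent_star_cosets_meet fsym firr f_xy (b_comm _ _ f_xy).
have c_d : ends_with f c d.
  by have := c_x _ x_d; rewrite -catA catVw cats0.
have -> : raag_eq f (z ++ b y) ((z ++ inv_word (d ++ inv_word (b y))) ++ d).
  by rewrite inv_word_cat inv_wordK -!catA catVw cats0.
apply: (ends_with_star (t := y) fsym firr c_s) => //; first by rewrite star_sym.
by apply: supported_cat => //; apply: supported_inv.
Qed.

Variable M : pred W.
Hypotheses (M_unseparated : unseparated_by_stars M)
  (M_uncovered : uncovered_by_two_stars M).

Lemma star_coset_ends_with_unseparated b c s x y : commuting_conjugates b ->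
  starts_only f s c -> M x -> M y -> ~~ star f s x -> ~~ star f s y ->
  star_coset_ends_with b c x -> star_coset_ends_with b c y.
Proof.
move=> b_comm c_s Mx My nsx nsy.
case/connectP: (M_unseparated Mx My nsx nsy) => p.
elim: p x {Mx nsx} => [|z p IH] x /=; first by move=> _ ->.
by case/andP=> xz /IH{}IH /IH{}IH /(star_coset_ends_with_adj b_comm c_s xz).
Qed.

Lemma exists_common_end b v : commuting_conjugates b ->
  M v -> 0 < length_off f (star f v) (b v) ->
  exists l, forall x, M x -> ~~ star f l.1 x -> star_coset_ends_with b [:: l] x.
Proof.
move=> b_comm Mv; rewrite -has_count => /hasP[a a_bv nva].
have nav : ~~ star f a.1 v by rewrite star_sym.
have [p [q bv_eq]] : exists p q, reduce f (b v) = p ++ a :: q.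
  by case/splitPr: a_bv => p q; exists p, q.
have [z [q' [q_eq q'_a]]] := starts_only_suffix fsym firr a q.
have v_ends : star_coset_ends_with b (a :: q') v.
  move=> y v_y; apply: (ends_with_star fsym firr q'_a nva v_y).
  have bv_eq' : trace_eq f (reduce f (b v)) ((p ++ z) ++ a :: q').
    by rewrite bv_eq -catA q_eq.
  exists (p ++ z); split; last by rewrite -bv_eq'; apply: reduced_reduce.
  by rewrite (raag_eq_reduce f (b v)); apply: trace_eq_raag_eq.
have [c [l c_l]] : exists c l, a :: q' = c ++ [:: l].
  by exists (belast a q'), (last a q'); rewrite cats1 -lastI.
have [x0 [Mx0 nax0 nlx0]] := M_uncovered a.1 l.1.
have x0_ends : star_coset_ends_with b [:: l] x0.
  move=> y x0_y; apply: (@ends_with_catr _ _ c); rewrite -c_l.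
  exact: (star_coset_ends_with_unseparated b_comm q'_a Mv Mx0).
exists l => x Mx nlx.
apply: (star_coset_ends_with_unseparated b_comm _ Mx0 Mx nlx0 nlx x0_ends).
by move=> l' /= /orP[/eqP->//|]; rewrite andbF.
Qed.

Theorem star_cosets_meet b : commuting_conjugates b ->
  exists p, forall x, M x -> supported f (star f x) (b x ++ inv_word p).
Proof.
have [n] := ubnP (\sum_(x | M x) length_off f (star f x) (b x)).
elim: n b => // n IH b /ltnSE le_n b_comm.
case: (boolP [forall x, M x ==> (length_off f (star f x) (b x) == 0)]).
  move/forallP => length0; exists [::] => x Mx; rewrite cats0; apply: length_off_eq0.
  exact/eqP/(implyP (length0 x)).
rewrite negb_forall => /existsP[v]; rewrite negb_imply -lt0n => /andP[Mv v_off].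
have [l l_end] := exists_common_end b_comm Mv v_off.
pose b' x := b x ++ [:: inv_letter l].
have length_lt x : M x -> ~~ star f l.1 x ->
    length_off f (star f x) (b x) = (length_off f (star f x) (b' x)).+1.
  move=> Mx nlx; apply: length_off_ends_with => //; first by rewrite star_sym.
  by apply: (l_end x Mx nlx [::]); apply: all_supported.
have length_le x :
    M x -> length_off f (star f x) (b' x) <= length_off f (star f x) (b x).
  move=> Mx; case: (boolP (star f l.1 x)) => [lx|nlx]; last by rewrite length_lt.
  by rewrite length_off_rcons // star_sym.
have [x0 [Mx0 nlx0 _]] := M_uncovered l.1 l.1.
have [|x y f_xy|p b'_p] := IH b'.
- apply: leq_trans le_n; rewrite (bigD1 x0) //= [X in _ < X](bigD1 x0) //=.
  rewrite length_lt // addSn ltnS leq_add2l leq_sum // => x /andP[Mx _].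
  exact: length_le.
- by rewrite /b' !conj_by_cat; apply/commutes_conj/b_comm.
- exists (p ++ [:: l]) => x /b'_p; rewrite /b' inv_word_cat -catA.
  by rewrite inv_word_cons.
Qed.

End StarCosets.

(** * Exponent sums of commuting elements *)

Section ExponentSums.
Local Open Scope ring_scope.
Variables (W : eqType) (f : rel W).
Hypotheses (fsym : symmetric f) (firr : irreflexive f).
Implicit Types (a b l : W * bool) (c x y z : word W) (s t : W).

Definition expsum t x : int := \sum_(a <- x | a.1 == t) (-1) ^+ a.2.

Lemma expsum_nil t : expsum t [::] = 0.
Proof. exact: big_nil. Qed.

Lemma expsum_cons t a x : expsum t (a :: x) = (a.1 == t)%:R * (-1) ^+ a.2 + expsum t x.
Proof. by rewrite /expsum big_cons; case: eqP; rewrite ?mul1r // mul0r add0r. Qed.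

Lemma expsum_cat t x y : expsum t (x ++ y) = expsum t x + expsum t y.
Proof. exact: big_cat. Qed.

Lemma expsum_inv t x : expsum t (inv_word x) = - expsum t x.
Proof.
elim: x => [|a x IH]; first by rewrite expsum_nil oppr0.
rewrite inv_word_cons expsum_cat IH !expsum_cons expsum_nil addr0 opprD addrC.
by rewrite signrN mulrN.
Qed.

Lemma expsum_raag_eq t x y : raag_eq f x y -> expsum t x = expsum t y.
Proof.
elim=> [_ _ []|//|? ? _ ->|? ? ? _ -> _ ->] //.
  move=> p q v b; rewrite !expsum_cat !expsum_cons expsum_nil /= signrN mulrN addr0.
  by rewrite subrr add0r.
move=> p q v b w b' _; rewrite !expsum_cat !expsum_cons expsum_nil !addr0.
by congr (_ + (_ + _)); rewrite addrC.
Qed.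

Lemma expsum_conj t c x : expsum t (conj_by c x) = expsum t x.
Proof. by rewrite /conj_by !expsum_cat expsum_inv addrCA addNr addr0. Qed.

Lemma expsum_gen s t : expsum t (gen s) = (s == t)%:R.
Proof. by rewrite expsum_cons expsum_nil addr0 mulr1. Qed.

Lemma expsum_nseq t n a : expsum t (nseq n a) = (a.1 == t)%:R * (-1) ^+ a.2 *+ n.
Proof.
elim: n => [|n IH]; first exact: expsum_nil.
by rewrite expsum_cons IH mulrS.
Qed.

Lemma expsum_pow t n x : expsum t (pow n x) = expsum t x *+ n.
Proof.
elim: n => [|n IH]; first exact: expsum_nil.
by rewrite powS expsum_cat IH mulrS.
Qed.

Lemma expsum_pair_proj s t x : expsum t (pair_proj s t x) = expsum t x.
Proof.
rewrite /expsum big_filter_cond; apply: eq_bigl => a.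
by case: (a.1 == t); rewrite ?andbT ?orbT ?andbF.
Qed.

(* The coefficient of [s t] in the Magnus expansion; it is an invariant of the group
   element when [s] and [t] do not commute. *)
Fixpoint magnus s t x : int :=
  if x is a :: x' then (a.1 == s)%:R * (-1) ^+ a.2 * expsum t x' + magnus s t x' else 0.

Lemma magnus_cat s t x y :
  magnus s t (x ++ y) = magnus s t x + magnus s t y + expsum s x * expsum t y.
Proof.
elim: x => [|a x IH] /=; first by rewrite expsum_nil; lia.
by rewrite IH expsum_cat expsum_cons; lia.
Qed.

Lemma magnus_raag_eq s t x y : s != t -> ~~ f s t -> raag_eq f x y ->
  magnus s t x = magnus s t y.
Proof.
move=> s_neq_t nf_st; elim=> [_ _ []|//|? ? _ ->|? ? ? _ -> _ ->] // p q.
  move=> v o; rewrite !magnus_cat !expsum_cat /= !expsum_cons !expsum_nil /= signrN.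
  case: (v =P s) => [->|_]; rewrite ?(negPf s_neq_t) /=; last by lia.
  by rewrite mul0r; lia.
move=> v o w o' f_vw; rewrite !magnus_cat !expsum_cat /= !expsum_cons !expsum_nil /=.
have : ~~ ((v == s) && (w == t)).
  by apply: contraNN nf_st => /andP[/eqP <- /eqP <-].
have : ~~ ((v == t) && (w == s)).
  by apply: contraNN nf_st => /andP[/eqP <- /eqP <-]; rewrite fsym.
by case: (v == s); case: (w == t); case: (v == t); case: (w == s) => //= _ _;
  rewrite ?mulr1n ?mulr0n; lia.
Qed.

Lemma commutes_expsum s t x y : s != t -> ~~ f s t -> commutes f x y ->
  expsum s x * expsum t y = expsum s y * expsum t x.
Proof. by move=> nst nf /(magnus_raag_eq nst nf); rewrite !magnus_cat; lia. Qed.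

Lemma reduced_single_generator s x : reduced f x -> all (fun l => l.1 == s) x ->
  exists o, x = nseq (size x) (s, o).
Proof.
elim: x => [|[t o] x IH] /=; first by exists false.
case/andP=> no red_x /andP[/eqP t_s x_s]; subst t.
have [o' x_eq] := IH red_x x_s; exists o; rewrite {1}x_eq.
case: x {IH red_x x_s} no x_eq => //= b x; rewrite negb_or => /andP[b_neq _] [b_eq _].
by move: b_neq; rewrite b_eq xpair_eqE eqxx /=; case: (o) (o') => [] [].
Qed.

End ExponentSums.

(** * Commuting with a cyclically reduced word *)

Lemma eventually_additive (L : nat -> nat) s b : L 0 <= b ->
  (forall n, n * s <= L n + b) -> (forall n, L n.+1 <= s + L n) ->
  exists n, L n.+1 = s + L n.
Proof.
move=> L0 L_ge L_succ.
case: (boolP [exists n : 'I_(2 * b).+1, L n.+1 == s + L n]) => [/existsP[n /eqP]|].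
  by exists n.
rewrite negb_exists => /forallP not_additive; exfalso.
have bound n : n <= (2 * b).+1 -> L n + n <= b + n * s.
  elim: n => [|n IH] lt_n; first by rewrite mul0n !addn0.
  have := not_additive (Ordinal lt_n) => /= neq_L.
  have := IH (ltnW lt_n); have := L_succ n.
  by move: neq_L; rewrite mulSn; move: (L n.+1) (L n) (n * s) => *; lia.
have := bound _ (leqnn _); have := L_ge (2 * b).+1.
by move: (L _) (_ * s) => *; lia.
Qed.

Section CyclicallyReduced.
Variables (W : eqType) (f : rel W).
Hypotheses (fsym : symmetric f) (firr : irreflexive f).
Implicit Types (a l : W * bool) (c x y w : word W) (t : W).

Lemma reduced_cyclic_reduction w : reduced f w ->
  exists c x, raag_eq f w (conj_by c x) /\ reduced f (x ++ x).
Proof.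
have [n] := ubnP (size w); elim: n w => // n IH w /ltnSE le_n red_w.
case: (reduced_cat_or_cancel fsym firr red_w red_w) => [red_ww|[a [p [q [w_pa w_aq]]]]].
  by exists [::], w; rewrite conj_by_nil.
have : initial f (inv_letter a) (p ++ [:: a]) by rewrite -w_pa w_aq /= eqxx.
rewrite initial_cat /= (eq_sym a) (negPf (inv_letter_neq a)) !andbF orbF.
move/(initial_trace_eq_rem fsym firr); move: (rem _ p) => p' p_eq.
have {}w_eq : trace_eq f w (inv_letter a :: p' ++ [:: a]) by rewrite w_pa p_eq.
have [||c [x [p'_eq red_xx]]] := IH p'.
- by move: le_n; rewrite (size_trace_eq firr w_eq) /= size_cat addn1 => /ltnW.
- by move: red_w; rewrite w_eq => /andP[_ /reduced_catl].
exists (c ++ [:: a]), x; split=> //.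
by rewrite conj_by_cat -p'_eq (trace_eq_raag_eq fsym firr w_eq).
Qed.

Lemma cyclic_reduction w : exists c x, raag_eq f w (conj_by c x) /\ reduced f (x ++ x).
Proof.
have [c [x [w_eq red_xx]]] := reduced_cyclic_reduction (reduced_reduce fsym firr w).
by exists c, x; rewrite {1}(raag_eq_reduce f w).
Qed.

Lemma reduced_pow x n : reduced f (x ++ x) -> reduced f (pow n x).
Proof.
move=> red_xx; elim: n => // n IH; rewrite powS.
case: n IH => [|n] IH; first by rewrite cats0; apply: reduced_catl red_xx.
have red_x := reduced_catl red_xx.
have [//|[a [p [q [x_eq pow_eq]]]]] := reduced_cat_or_cancel fsym firr red_x IH.
have : initial f (inv_letter a) (pow n.+1 x) by rewrite pow_eq /= eqxx.
rewrite powS initial_cat => /orP[/(initial_trace_eq_rem fsym firr) x_eq'|].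
  exfalso; move: red_xx; rewrite {1}x_eq x_eq' -catA => /reduced_catr.
  by rewrite /= eqxx.
rewrite /in_link (all_trace_eq firr _ x_eq) all_cat /= firr.
by rewrite andbF.
Qed.

(* Multiplying [y] by a high power of [x] makes all cancellation between [x] and
   [y] disappear, so that [x] and [y] commute as traces. *)
Lemma commutes_trace_eq_pow x y : reduced f (x ++ x) -> commutes f x y ->
  exists n, let z := reduce f (pow n x ++ y) in trace_eq f (x ++ z) (z ++ x).
Proof.
move=> red_xx xy; pose L n := size (reduce f (pow n x ++ y)).
have [||n|n Ln] := @eventually_additive L (size x) (size y).
- exact: size_reduce.
- move=> n; rewrite -size_pow -(reduce_id (reduced_pow n red_xx)).
  rewrite (@size_reduce_eq _ _ fsym firr _ (reduce f (pow n x ++ y) ++ inv_word y)).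
    by apply: leq_trans (size_reduce _ _) _; rewrite size_cat size_inv_word.
  by rewrite -raag_eq_reduce -catA catwV cats0.
- by rewrite /L powS -catA; apply: size_reduce_cat.
exists n => z; have xz : raag_eq f (x ++ z) (z ++ x).
  rewrite /z -raag_eq_reduce -/(commutes f _ _).
  by apply: commutes_cat => //; apply/commutes_pow/commutes_refl.
have red_xz : reduced f (x ++ z).
  apply: reduced_size; rewrite size_cat -/(L n) -Ln /L powS -catA.
  by rewrite (@size_reduce_eq _ _ fsym firr _ (x ++ z)) // /z -raag_eq_reduce.
apply: reduced_raag_eq => //; apply: reduced_size.
by rewrite -(size_reduce_eq fsym firr xz) (reduce_id red_xz) !size_cat addnC.
Qed.

(* The projections to [l.1] and [t] commute in a free monoid, hence have a common
   power. *)
Lemma trace_comm_expsum_eq0 x y l t : trace_eq f (x ++ y) (y ++ x) ->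
  l \in x -> ~~ f l.1 t -> expsum t x = 0%R -> expsum t y = 0%R.
Proof.
move=> xy l_x nf_lt x_t0; have := xy _ _ nf_lt.
rewrite !pair_proj_cat => /cat_comm_pow_eq/(congr1 (expsum t)).
rewrite !expsum_pow !expsum_pair_proj x_t0 mul0rn => /esym/eqP.
rewrite mulrn_eq0 => /orP[/nilP x_l0|/eqP//].
suff : l \in pair_proj l.1 t x by rewrite x_l0.
by rewrite mem_filter eqxx.
Qed.

Lemma commutes_in_link x y t : reduced f (x ++ x) -> commutes f x y ->
  expsum t x = 0%R -> expsum t y <> 0%R -> in_link f t x.
Proof.
move=> red_xx xy x_t0 y_t; have [n xz] := commutes_trace_eq_pow red_xx xy.
apply/allP => l l_x; apply: contraT => nf_lt; case: y_t.
have := trace_comm_expsum_eq0 xz l_x nf_lt x_t0.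
rewrite -(expsum_raag_eq t (raag_eq_reduce f _)) expsum_cat expsum_pow x_t0.
by rewrite mul0rn add0r.
Qed.

End CyclicallyReduced.

(** * Automorphisms for graphs without dominated vertices *)

Lemma perm_homo_mono (T : finType) (r : rel T) (s : {perm T}) :
  {homo s : x y / r x y} -> {mono s : x y / r x y}.
Proof.
move=> s_homo x y; apply/idP/idP; last exact: s_homo.
have iter_homo n u v : r u v -> r ((s ^+ n)%g u) ((s ^+ n)%g v).
  elim: n u v => [|n IH] u v r_uv; first by rewrite !perm1.
  by rewrite expgS !permM; apply/IH/s_homo.
move/(iter_homo #[s]%g.-1); rewrite -!permM -expgS prednK ?order_gt0 // expg_order.
by rewrite !perm1.
Qed.

Section SignedPermutations.
Variables (W : finType) (f : rel W).
Implicit Types (s : {perm W}) (o : W -> bool) (x v : W).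

Definition signed_perm s o v : word W := [:: (s v, o v)].

Definition signed_permV s o := signed_perm s^-1 (o \o s^-1)%g.

Lemma signed_permKV s o v : subst (signed_perm s o) (signed_permV s o v) = gen v.
Proof.
by rewrite /subst /= cats0 /signed_perm /inv_word permKV /=; case: (o _).
Qed.

Lemma signed_permK s o v : subst (signed_permV s o) (signed_perm s o v) = gen v.
Proof.
by rewrite /signed_permV /subst /= cats0 /signed_perm /inv_word /= permK /=; case: (o v).
Qed.

Lemma signed_perm_endo s o : {homo s : x y / f x y} -> is_endo f (signed_perm s o).
Proof. by move=> s_homo x y /s_homo f_xy; apply: (raag_eq_comm [::]). Qed.

Lemma signed_perm_auto s o : {homo s : x y / f x y} ->
  is_auto f (signed_perm s o) /\ is_auto f (signed_permV s o).
Proof.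
move=> s_homo; have endo := signed_perm_endo o s_homo.
have endoV : is_endo f (signed_permV s o).
  by apply: signed_perm_endo => x y f_xy; rewrite -(perm_homo_mono s_homo) !permKV.
split; split=> //; [exists (signed_permV s o)|exists (signed_perm s o)];
  by split=> // v; rewrite signed_permK signed_permKV.
Qed.

End SignedPermutations.

Section Automorphisms.
Variables (W : finType) (f : rel W).
Hypotheses (fsym : symmetric f) (firr : irreflexive f).
Implicit Types (s : {perm W}) (g h : W -> word W) (x y z v : W).

Definition undominated := forall x y, (forall z, f x z -> star f y z) -> x = y.

Lemma expsum_subst t g (w : word W) :
  expsum t (subst g w) = (\sum_x expsum x w * expsum t (g x))%R.
Proof.
elim: w => [|[v o] w IH].
  by rewrite expsum_nil big1 // => x _; rewrite expsum_nil mul0r.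
rewrite -cat1s subst_cat expsum_cat IH.
under [RHS]eq_bigr do rewrite expsum_cons mulrDl.
rewrite big_split /=; congr (_ + _)%R; rewrite (bigD1 v) //= big1 ?addr0 => [|x x_neq].
  rewrite eqxx mul1r /subst /= cats0; case: o; rewrite ?expsum_inv ?mul1r //.
  by rewrite expr1 mulN1r.
by rewrite eq_sym (negPf x_neq) !mul0r.
Qed.

Definition expsum_mx g : 'M[rat]_#|W| :=
  (\matrix_(i, j) (expsum (enum_val j) (g (enum_val i)))%:~R)%R.

Lemma expsum_left_inverse g h : (forall v, raag_eq f (subst h (g v)) (gen v)) ->
  forall x y, (\sum_z expsum z (g x) * expsum y (h z) = (x == y)%:R)%R.
Proof. by move=> hg x y; rewrite -expsum_subst (expsum_raag_eq _ (hg x)) expsum_gen. Qed.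

Lemma expsum_mx_unit g h :
  (forall v, raag_eq f (subst h (g v)) (gen v)) -> (expsum_mx g \in unitmx)%R.
Proof.
move=> /expsum_left_inverse hg.
suff /mulmx1_unit[] : (expsum_mx g *m expsum_mx h = 1%:M)%R by [].
apply/matrixP => i j; rewrite !mxE.
have -> : ((i == j)%:R = ((enum_val i == enum_val j)%:R : int)%:~R :> rat)%R.
  by rewrite (inj_eq enum_val_inj); case: (i == j).
rewrite -hg rmorph_sum /= [RHS](reindex_onto (@enum_val W W) enum_rank) /=; last first.
  by move=> x _; rewrite enum_rankK.
by apply: eq_big => [k|k _]; rewrite ?enum_valK ?eqxx // !mxE rmorphM.
Qed.

Definition abelian_signed_perm s g := forall x,
  (forall y, y != s x -> expsum y (g x) = 0%R) /\ `|expsum (s x) (g x)|%N = 1.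

Lemma auto_abelian_signed_perm g :
  undominated -> is_auto f g -> exists s, abelian_signed_perm s g.
Proof.
move=> undom [g_endo [h [_ gh]]]; have hg v := (gh v).2.
pose st (i j : 'I_#|W|) := star f (enum_val i) (enum_val j).
have [|i j dominated||i p q r|s s_mx] := @undominated_monomial rat #|W| st (expsum_mx g).
- by move=> i; apply: star_refl.
- apply/enum_val_inj/undom => t f_it; rewrite -(enum_rankK t); apply: dominated.
    by rewrite /st enum_rankK /star f_it orbT.
  by apply: contraTneq f_it => <-; rewrite enum_rankK firr.
- exact: expsum_mx_unit hg.
- rewrite /st !mxE -!rmorphM /star => st_ip; rewrite negb_or => /andP[r_neq_q nf_qr].
  congr (_%:~R)%R; apply: (commutes_expsum fsym) nf_qr _; rewrite 1?eq_sym //.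
  by case/orP: st_ip => [/eqP ->|]; [apply: commutes_refl|apply: g_endo].
have sW_inj : injective (fun x => enum_val (s (enum_rank x))).
  by move=> x y /enum_val_inj/perm_inj/enum_rank_inj.
have exp0 x y : y != perm sW_inj x -> expsum y (g x) = 0%R.
  move=> y_neq; apply: contraNeq y_neq => exp_neq0; rewrite permE -[y]enum_rankK.
  by rewrite (s_mx (enum_rank x) (enum_rank y)) // mxE !enum_rankK intr_eq0.
exists (perm sW_inj) => x; split=> [y|]; first exact: exp0.
have := expsum_left_inverse hg x x.
rewrite eqxx (bigD1 (perm sW_inj x)) //= big1 ?addr0 => [|z z_neq].
  by move/(congr1 absz); rewrite abszM => /eqP; rewrite muln_eq1 => /andP[/eqP].
by rewrite exp0 // mul0r.
Qed.

Section AbelianSignedPerm.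
Variables (s : {perm W}) (g : W -> word W).
Hypotheses (g_endo : is_endo f g) (g_s : abelian_signed_perm s g).

Lemma abelian_signed_perm_homo : {homo s : x y / f x y}.
Proof.
move=> x y f_xy; apply: contraT => nf_sxy.
have sxy_neq : s x != s y.
  by rewrite (inj_eq perm_inj); apply: contraTneq f_xy => ->; rewrite firr.
have := commutes_expsum fsym sxy_neq nf_sxy (g_endo f_xy).
case: (g_s x) (g_s y) => _ /eqP x1 [/(_ _ sxy_neq) -> /eqP y1].
by rewrite mul0r => /eqP; rewrite mulf_eq0 => /orP[]/eqP e; rewrite e in x1 y1.
Qed.

(* Every neighbour [t] of [s x] occurs with nonzero exponent in the image of a neighbour
   of [x], hence is joined to all letters of the cyclically reduced form of [g x]; as
   [s x] is undominated, these letters are all [s x]. *)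
Lemma endo_conj_signed_gen x : undominated ->
  exists o c, raag_eq f (g x) (conj_by c [:: (s x, o)]).
Proof.
move=> undom; have [c [w [gx_eq red_ww]]] := cyclic_reduction fsym firr (g x).
have exp_w t : expsum t w = expsum t (g x).
  by rewrite (expsum_raag_eq t gx_eq) expsum_conj.
have w_single : all (fun l => l.1 == s x) w.
  apply/allP => l l_w; apply/eqP/esym/undom => t f_sx_t.
  have [z t_eq] : exists z, t = s z by exists ((s^-1)%g t); rewrite permKV.
  have f_xz : f x z by rewrite -(perm_homo_mono abelian_signed_perm_homo) -t_eq.
  suff /allP/(_ l l_w) f_lt : in_link f t w by rewrite /star f_lt orbT.
  apply: (@commutes_in_link _ _ fsym firr w (conj_by (inv_word c) (g z))) => //.
  + rewrite -(conj_byK f c w); apply/commutes_conj.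
    by rewrite -gx_eq; apply: g_endo.
  + by rewrite exp_w (g_s x).1 //; apply: contraTneq f_sx_t => ->; rewrite firr.
  + by rewrite expsum_conj t_eq => exp0; have := (g_s z).2; rewrite exp0.
have [o w_eq] := reduced_single_generator (reduced_catl red_ww) w_single.
exists o, c; suff size_w : size w = 1 by rewrite gx_eq w_eq size_w.
have := (g_s x).2; rewrite -exp_w w_eq size_nseq.
by rewrite expsum_nseq eqxx mul1r -mulr_natr abszMsign natz.
Qed.

End AbelianSignedPerm.

Theorem auto_conj_signed_perm g : undominated -> is_auto f g ->
  exists s (o : {ffun W -> bool}), {homo s : x y / f x y} /\
    forall x, exists c, raag_eq f (g x) (conj_by c (signed_perm s o x)).
Proof.
move=> undom g_auto; have [s g_s] := auto_abelian_signed_perm undom g_auto.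
have /fin_all_exists[o g_o] x := endo_conj_signed_gen g_auto.1 g_s x undom.
exists s, (finfun o); split=> [|x]; first exact: abelian_signed_perm_homo g_auto.1 g_s.
by have [c gx_eq] := g_o x; exists c; rewrite /signed_perm ffunE.
Qed.

Theorem PSA_finite_index : undominated ->
  exists (n : nat) (L : 'I_n -> W -> word W), (forall i, is_auto f (L i)) /\
    forall g, is_auto f g ->
      exists i (p : W -> word W), is_PSA f p /\ out_eq f g (aut_comp (L i) p).
Proof.
move=> undom; pose homo s := [forall x, forall y, f x y ==> f (s x) (s y)].
have homoP s : reflect {homo s : x y / f x y} (homo s).
  apply: (iffP 'forall_forallP) => s_homo x y; apply/implyP; exact: s_homo.
pose T := {so : {perm W} * {ffun W -> bool} | homo so.1}.
pose L (i : 'I_#|{: T}|) : W -> word W :=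
  signed_perm (val (enum_val i)).1 (val (enum_val i)).2.
exists #|{: T}|, L; split=> [i|g g_auto].
  by have [] := signed_perm_auto (val (enum_val i)).2 (homoP _ (valP (enum_val i))).
have [s [o [s_homo g_so]]] := auto_conj_signed_perm undom g_auto.
have so_homo : homo (s, o).1 by apply/homoP.
exists (enum_rank (Sub (s, o) so_homo : T)); rewrite /L enum_rankK SubK /=.
have [_ soV_auto] := signed_perm_auto o s_homo.
exists (aut_comp (signed_permV s o) g); split; last first.
  exists [::] => v; rewrite conj_by_nil /aut_comp subst_comp.
  rewrite -{1}[g v]subst_id; apply: subst_ext => w.
  by rewrite /aut_comp signed_permKV.
split=> [|v]; first exact: aut_comp_auto.
have [c gv_eq] := g_so v; exists (subst (signed_permV s o) c).
by rewrite /aut_comp (subst_raag_eq soV_auto.1 gv_eq) subst_conj signed_permK.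
Qed.

End Automorphisms.

(** * The graph *)

Ltac case_ord5 i := case: i => [[|[|[|[|[|//]]]]] ?].

Lemma ordS_neq (i : 'I_5) : ordS i != i.
Proof. by case_ord5 i. Qed.

Lemma iter_ordS5 (i : 'I_5) : iter 5 (@ordS 5) i = i.
Proof. by apply: val_inj; case_ord5 i. Qed.

Lemma mem_traject_ordS5 (i j : 'I_5) : j \in traject (@ordS 5) i 5.
Proof. by case_ord5 i; case_ord5 j. Qed.

Section Pentagon.
Variables (T : finType) (r : rel T) (h : 'I_5 -> T).

Lemma connect_pentagon : (forall i, r (h i) (h (ordS i))) ->
  forall i j, connect r (h i) (h j).
Proof.
move=> r_h i j; apply: (@connect_cycle _ r (map h (traject (@ordS 5) i 5))).
- by rewrite /= !r_h -[X in r _ (h X)](iter_ordS5 i) r_h.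
- by rewrite map_f ?mem_traject_ordS5.
- by rewrite map_f ?mem_traject_ordS5.
Qed.

Lemma connect_pentagon_minus o :
  (forall i, i != o -> ordS i != o -> r (h i) (h (ordS i))) ->
  forall i, i != o -> connect r (h (ordS o)) (h i).
Proof.
move=> r_h i i_neq.
apply: (@path_connect _ r _ (map h (traject (@ordS 5) (ordS (ordS o)) 3))).
  by rewrite /= !r_h //; clear; case_ord5 o.
by rewrite -map_cons; apply: map_f; move: i_neq; clear; case_ord5 o; case_ord5 i.
Qed.

End Pentagon.

(* The [Base v] are the vertices of the given graph, joined to all the [Sep i], so that
   removing the star of [Base v] separates the [Inner i] from the rest. The [Guard v]
   and the [Outer i] exclude dominated vertices and further separating stars. *)
Inductive vert (V : Type) :=
  Base of V | Guard of V | Sep of 'I_5 | Inner of 'I_5 | Outer of 'I_5.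
Arguments Sep {V}.
Arguments Inner {V}.
Arguments Outer {V}.

Definition vert_code (V : Type) (x : vert V) : V + V + ('I_5 + 'I_5 + 'I_5) :=
  match x with
  | Base v => inl (inl v)
  | Guard v => inl (inr v)
  | Sep i => inr (inl (inl i))
  | Inner i => inr (inl (inr i))
  | Outer i => inr (inr i)
  end.

Definition vert_decode (V : Type) (c : V + V + ('I_5 + 'I_5 + 'I_5)) : vert V :=
  match c with
  | inl (inl v) => Base v
  | inl (inr v) => Guard v
  | inr (inl (inl i)) => Sep i
  | inr (inl (inr i)) => Inner i
  | inr (inr i) => Outer i
  end.

Lemma vert_codeK (V : Type) : cancel (@vert_code V) (@vert_decode V).
Proof. by case. Qed.

HB.instance Definition _ (V : finType) := Finite.copy (vert V) (can_type (@vert_codeK V)).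

Section Construction.
Variables (V : finType) (e : rel V).
Hypotheses (esym : symmetric e) (eirr : irreflexive e).
Implicit Types (u x y : vert V) (v : V) (i j k : 'I_5).

Definition arc x y : bool :=
  match x, y with
  | Base v, Base w => e v w
  | Base v, Guard w => v == w
  | Base _, Sep _ => true
  | Guard _, Outer i => i < 2
  | Sep i, Inner j => i == j
  | Sep i, Outer j => i == j
  | Inner i, Inner j => j == ordS i
  | Outer i, Outer j => j == ordS i
  | _, _ => false
  end.

Definition edge x y := arc x y || arc y x.

Lemma edge_sym : symmetric edge.
Proof. by move=> x y; rewrite /edge orbC. Qed.

Lemma edge_irr : irreflexive edge.
Proof.
by case=> [v|v|i|i|i] //; rewrite /edge /= orbb ?eirr // eq_sym (negPf (ordS_neq i)).
Qed.

Lemma edge_Base v w : edge (Base v) (Base w) = e v w.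
Proof. by rewrite /edge /= (esym w v) orbb. Qed.

(* Equality of vertices, in a form that simplification computes. *)
Definition vert_eqb x y : bool :=
  match x, y with
  | Base v, Base w | Guard v, Guard w => v == w
  | Sep i, Sep j | Inner i, Inner j | Outer i, Outer j => i == j
  | _, _ => false
  end.

Lemma starE x y : star edge x y = vert_eqb y x || (arc x y || arc y x).
Proof. by rewrite /star; case: y => ?; case: x. Qed.

(* In each case two or three neighbours of [x] determine it. *)
Lemma undominated_edge : undominated edge.
Proof.
move=> x y dominated.
have {}dominated z : arc x z || arc z x -> vert_eqb z y || (arc y z || arc z y).
  by rewrite -starE; apply: dominated.
case: x dominated => [v|v|i|i|i] dominated.
- move: (dominated (Guard v)) (dominated (Sep ord0)) (dominated (Sep ord_max)).
  rewrite /= eqxx => /(_ isT) y_guard /(_ isT) y_sep0 /(_ isT) y_sep4.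
  case: y y_guard y_sep0 y_sep4 {dominated} => [w|w|j|j|j] //=; last by case_ord5 j.
  by rewrite orbF => /eqP->.
- move: (dominated (Base v)) (dominated (Outer ord0)) (dominated (Outer (ordS ord0))).
  rewrite /= eqxx => /(_ isT) y_base /(_ isT) y_out0 /(_ isT) y_out1.
  case: y y_base y_out0 y_out1 {dominated} => [w|w|j|j|j] //=; last by case_ord5 j.
  by move/eqP->.
- move: (dominated (Inner i)) (dominated (Outer i)).
  rewrite /= eqxx => /(_ isT) y_inner /(_ isT) y_outer.
  case: y y_inner y_outer {dominated} => [w|w|j|j|j] //=.
  by rewrite orbF => /eqP->.
- move: (dominated (Sep i)) (dominated (Inner (ordS i))) (dominated (Inner (ord_pred i))).
  rewrite /= !eqxx ord_predK eqxx orbT => /(_ isT) y_sep /(_ isT) y_succ /(_ isT) y_pred.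
  case: y y_sep y_succ y_pred {dominated} => [w|w|j|j|j] //=; last by move/eqP->.
  by move=> _; case_ord5 i; case_ord5 j.
- move: (dominated (Sep i)) (dominated (Outer (ordS i))) (dominated (Outer (ord_pred i))).
  rewrite /= !eqxx ord_predK eqxx orbT => /(_ isT) y_sep /(_ isT) y_succ /(_ isT) y_pred.
  case: y y_sep y_succ y_pred {dominated} => [w|w|j|j|j] //=; last by move/eqP->.
  by move=> _; case_ord5 i; case_ord5 j.
Qed.

Definition base x := if x is Base _ then true else false.
Definition inner x := if x is Inner _ then true else false.
Definition inner_or_sep x := match x with Inner _ | Sep _ => true | _ => false end.

Local Notation linked u := (connect (off_star edge u)).

Lemma off_star_sym u : connect_sym (off_star edge u).
Proof.
by apply: sym_connect_sym => x y; rewrite /off_star andbCA edge_sym.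
Qed.

Lemma connect_off_snoc u x y z :
  linked u x y -> off_star edge u y z -> linked u x z.
Proof. by move=> xy yz; apply: connect_trans xy (connect1 yz). Qed.

Lemma off_starE u x y : off_star edge u x y =
  [&& ~~ (vert_eqb x u || (arc u x || arc x u)),
      ~~ (vert_eqb y u || (arc u y || arc y u)) & arc x y || arc y x].
Proof. by rewrite -!starE. Qed.

Lemma connect_Inner u i j : (forall k, ~~ star edge u (Inner k)) ->
  linked u (Inner i) (Inner j).
Proof.
by move=> off_u; apply: connect_pentagon => k; rewrite /off_star !off_u /edge /= eqxx.
Qed.

Lemma connect_Outer u i j : (forall k, ~~ star edge u (Outer k)) ->
  linked u (Outer i) (Outer j).
Proof.
by move=> off_u; apply: connect_pentagon => k; rewrite /off_star !off_u /edge /= eqxx.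
Qed.

Lemma connect_off_Guard v x : ~~ star edge (Guard v) x ->
  linked (Guard v) (Inner ord0) x.
Proof.
have to_inner i : linked (Guard v) (Inner ord0) (Inner i) by apply: connect_Inner.
have to_sep i : linked (Guard v) (Inner ord0) (Sep i).
  by apply: connect_off_snoc (to_inner i) _; rewrite off_starE /= ?orbF eqxx.
have to_base w : w != v -> linked (Guard v) (Inner ord0) (Base w).
  move=> w_neq; apply: connect_off_snoc (to_sep ord0) _.
  by rewrite off_starE /= ?orbF w_neq.
case: x => [w|w|i|i|i] //; rewrite starE /= => x_off.
- exact: to_base.
- have w_neq : w != v by move: x_off; rewrite orbF.
  apply: connect_off_snoc (to_base _ w_neq) _.
  by rewrite off_starE /= ?orbF w_neq eqxx.
- by apply: connect_off_snoc (to_sep i) _; rewrite off_starE /= x_off ?orbF eqxx.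
Qed.

Lemma connect_off_Sep k x : ~~ star edge (Sep k) x ->
  linked (Sep k) (Outer (ordS k)) x.
Proof.
have to_outer i : i != k -> linked (Sep k) (Outer (ordS k)) (Outer i).
  apply: connect_pentagon_minus => j j_neq j'_neq.
  by rewrite off_starE /= ?orbF !(eq_sym k) j_neq j'_neq eqxx.
have to_sep i : i != k -> linked (Sep k) (Outer (ordS k)) (Sep i).
  move=> i_neq; apply: connect_off_snoc (to_outer i i_neq) _.
  by rewrite off_starE /= ?orbF eq_sym i_neq eqxx.
case: x => [w|w|i|i|i]; rewrite starE //= ?orbF => x_off.
- have [i lt_i2 i_neq] : exists2 i : 'I_5, i < 2 & i != k.
    by clear; case_ord5 k; [exists (ordS ord0)|exists ord0..].
  apply: connect_off_snoc (to_outer i i_neq) _.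
  by rewrite off_starE /= ?orbF eq_sym i_neq lt_i2.
- exact: to_sep.
- have i_neq : i != k by rewrite eq_sym.
  apply: connect_off_snoc (to_sep i i_neq) _.
  by rewrite off_starE /= ?orbF i_neq x_off eqxx.
- by apply: to_outer; rewrite eq_sym.
Qed.

Lemma connect_off_Inner k x : ~~ star edge (Inner k) x ->
  linked (Inner k) (Outer ord0) x.
Proof.
have to_outer i : linked (Inner k) (Outer ord0) (Outer i) by apply: connect_Outer.
have to_guard w : linked (Inner k) (Outer ord0) (Guard w).
  by apply: connect_off_snoc (to_outer ord0) _; rewrite off_starE.
have to_sep i : i != k -> linked (Inner k) (Outer ord0) (Sep i).
  move=> i_neq; apply: connect_off_snoc (to_outer i) _.
  by rewrite off_starE /= ?orbF i_neq eqxx.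
case: x => [w|w|i|i|i] //; rewrite starE /= => x_off.
- apply: connect_off_snoc (to_guard w) _.
  by rewrite off_starE /= ?orbF eqxx.
- exact: to_sep.
- have i_neq : i != k by move: x_off; rewrite negb_or => /andP[].
  apply: connect_off_snoc (to_sep i i_neq) _.
  by rewrite off_starE /= ?orbF i_neq x_off eqxx.
Qed.

Lemma connect_off_Outer k x : ~~ star edge (Outer k) x ->
  linked (Outer k) (Inner ord0) x.
Proof.
have to_inner i : linked (Outer k) (Inner ord0) (Inner i) by apply: connect_Inner.
have to_sep i : i != k -> linked (Outer k) (Inner ord0) (Sep i).
  move=> i_neq; apply: connect_off_snoc (to_inner i) _.
  by rewrite off_starE /= ?orbF i_neq eqxx.
have to_base w : linked (Outer k) (Inner ord0) (Base w).
  apply: connect_off_snoc (to_sep _ (ordS_neq k)) _.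
  by rewrite off_starE /= ?orbF ordS_neq.
case: x => [w|w|i|i|i] //; rewrite starE /= => x_off.
- apply: connect_off_snoc (to_base w) _.
  by rewrite off_starE /= ?orbF x_off eqxx.
- exact: to_sep.
- have i_neq : i != k by move: x_off; rewrite negb_or => /andP[].
  apply: connect_off_snoc (to_sep i i_neq) _.
  by rewrite off_starE /= ?orbF i_neq x_off eqxx.
Qed.

Lemma connect_off_Base v x : ~~ inner x -> ~~ star edge (Base v) x ->
  linked (Base v) (Outer ord0) x.
Proof.
have to_outer i : linked (Base v) (Outer ord0) (Outer i) by apply: connect_Outer.
have to_guard w : w != v -> linked (Base v) (Outer ord0) (Guard w).
  move=> w_neq; apply: connect_off_snoc (to_outer ord0) _.
  by rewrite off_starE /= ?orbF eq_sym w_neq.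
case: x => [w|w|i|i|i] // _; rewrite starE /= => x_off.
- have w_neq : w != v by move: x_off; rewrite negb_or => /andP[].
  apply: connect_off_snoc (to_guard w w_neq) _.
  by rewrite off_starE /= ?orbF eq_sym w_neq x_off eqxx.
- by apply: to_guard; move: x_off; rewrite orbF eq_sym.
Qed.

Lemma unseparated_by_stars_edge (M : pred (vert V)) :
  (forall v, exists hub, forall x,
     M x -> ~~ star edge (Base v) x -> linked (Base v) hub x) ->
  unseparated_by_stars edge M.
Proof.
move=> off_Base u x y Mx My x_off y_off.
suff [hub to_hub] : exists hub, forall z,
    M z -> ~~ star edge u z -> linked u hub z.
  apply: connect_trans (to_hub y My y_off).
  by rewrite off_star_sym to_hub.
case: u {x_off y_off} => [v|v|k|k|k]; first exact: off_Base.
- by exists (Inner ord0) => z _; apply: connect_off_Guard.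
- by exists (Outer (ordS k)) => z _; apply: connect_off_Sep.
- by exists (Outer ord0) => z _; apply: connect_off_Inner.
- by exists (Inner ord0) => z _; apply: connect_off_Outer.
Qed.

Lemma unseparated_not_inner : unseparated_by_stars edge [pred x | ~~ inner x].
Proof.
apply: unseparated_by_stars_edge => v.
by exists (Outer ord0); apply: connect_off_Base.
Qed.

Lemma unseparated_inner_or_sep : unseparated_by_stars edge inner_or_sep.
Proof.
apply: unseparated_by_stars_edge => v.
by exists (Inner ord0); case=> // i _ _; apply: connect_Inner.
Qed.

Lemma star_contains_one_Sep u :
  ~~ base u -> exists i, forall j, j != i -> ~~ star edge u (Sep j).
Proof.
case: u => [v|v|i|i|i] // _.
- by exists ord0 => j _; rewrite starE.
- by exists i => j j_neq; rewrite starE /= orbF.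
- by exists i => j j_neq; rewrite starE.
- by exists i => j j_neq; rewrite starE.
Qed.

Lemma star_avoids_Outer u : exists i, ~~ star edge u (Outer i).
Proof.
case: u => [v|v|i|i|i].
- by exists ord0; rewrite starE.
- by exists ord_max; rewrite starE.
- by exists (ordS i); rewrite starE /= orbF eq_sym; apply: ordS_neq.
- by exists ord0; rewrite starE.
- by exists (ordS (ordS i)); rewrite starE /=; case_ord5 i.
Qed.

Lemma star_avoids_Inner u : exists i, ~~ star edge u (Inner i).
Proof.
case: u => [v|v|i|i|i].
- by exists ord0; rewrite starE.
- by exists ord0; rewrite starE.
- by exists (ordS i); rewrite starE /= orbF eq_sym; apply: ordS_neq.
- by exists (ordS (ordS i)); rewrite starE /=; case_ord5 i.
- by exists ord0; rewrite starE.
Qed.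

Lemma uncovered_by_two_stars_edge (M : pred (vert V)) : (forall i, M (Sep i)) ->
  (forall v u, exists x, [/\ M x, ~~ star edge (Base v) x & ~~ star edge u x]) ->
  uncovered_by_two_stars edge M.
Proof.
move=> M_Sep off_Base u u'; case: (boolP (base u)) => [|nu]; first by case: u.
case: (boolP (base u')) => [|nu'].
  by case: u' => // v _; have [x []] := off_Base v u; exists x.
have [i off_u] := star_contains_one_Sep nu; have [i' off_u'] := star_contains_one_Sep nu'.
suff [j j_neq_i j_neq_i'] : exists2 j, j != i & j != i'.
  by exists (Sep j); split; [apply: M_Sep|apply: off_u|apply: off_u'].
clear; case_ord5 i; case_ord5 i';
by [exists ord0|exists ord_max|exists (ordS ord0)].
Qed.

Lemma uncovered_not_inner : uncovered_by_two_stars edge [pred x | ~~ inner x].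
Proof.
apply: uncovered_by_two_stars_edge => // v u.
by have [i off_u] := star_avoids_Outer u; exists (Outer i); rewrite starE.
Qed.

Lemma uncovered_inner_or_sep : uncovered_by_two_stars edge inner_or_sep.
Proof.
apply: uncovered_by_two_stars_edge => // v u.
by have [i off_u] := star_avoids_Inner u; exists (Inner i); rewrite starE.
Qed.

(** * The isomorphism *)

Implicit Types w : word V.

Definition base_word (w : word V) : word (vert V) := [seq (Base l.1, l.2) | l <- w].

Lemma base_word_cat w w' : base_word (w ++ w') = base_word w ++ base_word w'.
Proof. exact: map_cat. Qed.

#[local] Instance base_word_raag_eq :
  Proper (raag_eq e ==> raag_eq edge) base_word.
Proof.
move=> w w'; apply: raag_eq_homo => _ _ [x y v b|x y v b v' b' e_vv'];
  rewrite !base_word_cat.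
  exact: (raag_eq_free edge (Base v, b)).
by apply: raag_eq_comm; rewrite edge_Base.
Qed.

Definition base_part (w : word (vert V)) : word V :=
  pmap (fun l => if l.1 is Base v then Some (v, l.2) else None) w.

Lemma base_wordK : cancel base_word base_part.
Proof. by elim=> //= -[v b] w IH; rewrite /base_part /= -/(base_part _) IH. Qed.

Lemma base_partK (w : word (vert V)) :
  all (fun l => base l.1) w -> base_word (base_part w) = w.
Proof.
elim: w => //= -[[] // v b] w IH /andP[/= _ /IH].
by rewrite /base_part /= -/(base_part _) => ->.
Qed.

#[local] Instance base_part_raag_eq :
  Proper (raag_eq edge ==> raag_eq e) base_part.
Proof.
move=> w w'; apply: raag_eq_homo => _ _ [x y u b|x y u b u' b' e_uu'];
  rewrite /base_part !pmap_cat.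
  by case: u => //= v; apply: (raag_eq_free e (v, b)).
by case: u u' e_uu' => //= v []//= v' e_vv'; apply: raag_eq_comm; rewrite -edge_Base.
Qed.

Lemma supported_base_word w : supported edge base (base_word w).
Proof. by apply: all_supported; rewrite all_map; elim: w. Qed.

Definition inner_conj (w : word V) x : word (vert V) :=
  if inner x then conj_by (base_word w) (gen x) else gen x.

Lemma subst_inner_conj_base_word w w' :
  subst (inner_conj w) (base_word w') = base_word w'.
Proof.
elim: w' => // -[v b] w' IH; rewrite -[_ :: w']cat1s base_word_cat subst_cat IH.
by congr (_ ++ _); case: b.
Qed.

Lemma inner_conj_cat w w' x :
  inner_conj (w ++ w') x = aut_comp (inner_conj w) (inner_conj w') x.
Proof.
rewrite /aut_comp {1 3}/inner_conj; case: ifP => inner_x.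
  rewrite subst_conj subst_inner_conj_base_word subst_gen /inner_conj inner_x.
  by rewrite base_word_cat conj_by_cat.
by rewrite subst_gen /inner_conj inner_x.
Qed.

Lemma inner_conj_nil x : inner_conj [::] x = gen x.
Proof. by rewrite /inner_conj conj_by_nil; case: inner. Qed.

Lemma inner_conj_raag_eq w w' x :
  raag_eq e w w' -> raag_eq edge (inner_conj w x) (inner_conj w' x).
Proof. by move=> ww'; rewrite /inner_conj; case: inner; rewrite ?ww'. Qed.

Lemma inner_conj_inner_or_sep w x : inner_or_sep x ->
  raag_eq edge (inner_conj w x) (conj_by (base_word w) (gen x)).
Proof.
rewrite /inner_conj; case: x => // i _; symmetry; apply/conj_by_idP/star_commutes.
by apply: all_supported; rewrite all_map; apply/allP => l _; rewrite /= starE.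
Qed.

Lemma edge_inner x y :
  edge x y -> inner x || inner y -> inner_or_sep x && inner_or_sep y.
Proof. by case: x; case: y. Qed.

Lemma inner_conj_endo w : is_endo edge (inner_conj w).
Proof.
move=> x y exy; have gen_xy : commutes edge (gen x) (gen y) by apply: gen_endo.
case: (boolP (inner x || inner y)) => [/(edge_inner exy)/andP[x_in y_in]|].
  by rewrite !inner_conj_inner_or_sep //; apply/commutes_conj.
by rewrite negb_or /inner_conj => /andP[/negPf-> /negPf->].
Qed.

Lemma inner_conj_PSA w : is_PSA edge (inner_conj w).
Proof.
split=> [|x]; last first.
  rewrite /inner_conj; case: inner; first by exists (base_word w).
  by exists [::]; rewrite conj_by_nil.
split; first exact: inner_conj_endo.
exists (inner_conj (inv_word w)); split=> [|x]; first exact: inner_conj_endo.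
rewrite -!/(aut_comp _ _ _) -!inner_conj_cat -(inner_conj_nil x).
by split; apply: inner_conj_raag_eq; [apply: catwV|apply: catVw].
Qed.

(* No two stars cover the fixed vertices, so nothing else centralizes them. *)
Lemma inner_conj_conjugator_eq1 w w' c :
  (forall x, raag_eq edge (inner_conj w x) (conj_by c (inner_conj w' x))) ->
  raag_eq edge c [::].
Proof.
move=> w_w'; apply: (supported_eq1 edge_sym edge_irr) => x.
have [y [/= ny nxy _]] := uncovered_not_inner x x.
exists (star edge y); first by rewrite star_sym //; apply: edge_sym.
apply/(commutes_genP edge_sym edge_irr)/conj_by_idP; have := w_w' y.
by rewrite /inner_conj (negPf ny) => <-.
Qed.

Lemma inner_conj_inj w w' :
  out_eq edge (inner_conj w) (inner_conj w') -> raag_eq e w w'.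
Proof.
case=> c w_w'; have c1 := inner_conj_conjugator_eq1 w_w'.
have := w_w' (Inner ord0); rewrite /inner_conj /= c1 conj_by_nil.
move/conj_by_eqP/(commutes_genP edge_sym edge_irr) => inner_ww'.
rewrite -[w]base_wordK -[w']base_wordK; apply: base_part_raag_eq.
apply/(raag_eq_cat2r _ (inv_word (base_word w'))); rewrite catwV.
apply: (supported_eq1 edge_sym edge_irr) => x; case: (boolP (base x)) => base_x.
  by exists (star edge (Inner ord0)) => //; case: x base_x => // v _; rewrite starE.
exists base => //; apply: supported_cat; last apply: supported_inv;
exact: supported_base_word.
Qed.

Lemma all_base_reduce (z : word (vert V)) :
  (forall i, supported edge (star edge (Sep i)) z) ->
  all (fun l => base l.1) (reduce edge z).
Proof.
move=> z_star; apply/allP => l l_z.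
have l_star i : star edge (Sep i) l.1.
  exact: (allP (supported_reduce edge_sym edge_irr (z_star i)) l l_z).
move: (l_star ord0) (l_star ord_max); rewrite !starE.
by case: (l.1) => [v|v|j|j|j] //=; case_ord5 j.
Qed.

Lemma inner_conj_surj g : is_PSA edge g -> exists w, out_eq edge (inner_conj w) g.
Proof.
move=> [[g_endo _] /fin_all_exists[b g_b]].
have b_comm : commuting_conjugates edge b.
  by move=> x y exy; rewrite -!g_b; apply: g_endo.
have [p p_b] := star_cosets_meet edge_sym edge_irr unseparated_not_inner
  uncovered_not_inner b_comm.
have [q q_b] := star_cosets_meet edge_sym edge_irr unseparated_inner_or_sep
  uncovered_inner_or_sep b_comm.
have g_conj x c : supported edge (star edge x) (b x ++ inv_word c) ->
    raag_eq edge (g x) (conj_by c (gen x)).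
  by move=> x_bc; rewrite g_b; apply/conj_by_eqP/(commutes_genP edge_sym edge_irr).
pose z := q ++ inv_word p.
have z_base : all (fun l => base l.1) (reduce edge z).
  apply: all_base_reduce => i.
  have := supported_cat (supported_inv (q_b (Sep i) isT)) (p_b (Sep i) isT).
  by rewrite inv_word_cat inv_wordK -!catA catVwK.
exists (base_part (reduce edge z)), (inv_word p) => x.
rewrite /inner_conj; case: (boolP (inner x)) => inner_x; last first.
  by rewrite (g_conj x p (p_b x inner_x)) conj_byK.
have x_in : inner_or_sep x by case: x inner_x.
rewrite (base_partK z_base) -(raag_eq_reduce edge z).
by rewrite (g_conj x q (q_b x x_in)) -conj_by_cat.
Qed.

End Construction.

Theorem theorem3p1 (V : finType) (e : rel V) (esym : symmetric e)
    (eirr : irreflexive e) :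
  exists (W : finType) (f : rel W), symmetric f /\ irreflexive f /\
    (* (1) A_e is isomorphic to PSO(A_f), via Phi (classes in Out represented
       by pure symmetric automorphisms) *)
    (exists Phi : word V -> (W -> word W),
       (forall w, is_PSA f (Phi w)) /\
       (forall w1 w2, raag_eq e w1 w2 <-> out_eq f (Phi w1) (Phi w2)) /\
       (forall w1 w2, out_eq f (Phi (w1 ++ w2)) (aut_comp (Phi w1) (Phi w2))) /\
       (forall g, is_PSA f g -> exists w, out_eq f (Phi w) g)) /\
    (* (2) PSO(A_f) has finite index in Out(A_f): finitely many cosets *)
    (exists (n : nat) (L : 'I_n -> W -> word W),
       (forall i, is_auto f (L i)) /\
       forall g, is_auto f g ->
         exists i p, is_PSA f p /\ out_eq f g (aut_comp (L i) p)).
Proof.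
exists (vert V), (edge e); split; first exact: edge_sym.
split; first exact: edge_irr.
split; last first.
  exact: PSA_finite_index (edge_sym e) (edge_irr eirr) (@undominated_edge _ e).
exists (@inner_conj V); split; first exact: inner_conj_PSA.
split; [|split]; last by move=> g; apply: inner_conj_surj.
  move=> w w'; split; last exact: inner_conj_inj.
  by move=> ww'; exists [::] => x; rewrite conj_by_nil; apply: inner_conj_raag_eq.
by move=> w w'; exists [::] => x; rewrite conj_by_nil inner_conj_cat.
Qed.
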